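(* Let $\theta\ge1$, $M,N,\eta>0$, $\lambda>\frac12$, $\eta_0\ge0$, $R\ge1$ be constants and let $\rho:\mathbb Z^+\to(0,\infty)$ satisfy $\sum_{i}\rho(i)<\infty$ and $\rho(\gamma)/\rho(j)\le N$ whenever $|\gamma-j|\le R$. Let $a_{i,i-1},a_{i-1,i}$ ($i\ge2$) be real numbers with $a_{i,i-1}\ne0$ and $\max\{|a_{i-1,i}|,|a_{i,i-1}|\}\le M$ for all $i\ge2$. Let $f\in C^\infty(\mathbb R,\mathbb R)$ satisfy $f(z)z\le\eta-\lambda|z|^2$ and $|f(z)|\le\eta_0(1+|z|^\theta)$ for all $z\in\mathbb R$. Assume $2M<\lambda-\frac12$. Assume moreover that there are $r,M_1,M_2>0$ and $N_1\in\mathbb Z^+$ with $\rho(n)\ge M_1e^{-rn}$ for all $n\ge N_1$ and $\limsup_{n\to\infty}\rho(n)/\inf_{1\le i\le n}\rho(i)\le M_2$; and that $f=f_1+f_2+f_3$, where $f_2$ is globally Lipschitz, there is $\xi\in\mathbb R$ such that $z\mapsto f_3(z)+\xi z$ is monotonically decreasing, and $|f_1(z)-f_1(\tilde z)|\le L(n)|z-\tilde z|$ for all $n\in\mathbb N$ and $z,\tilde z\in[-n,n]$, where $L:\mathbb N\to(0,\infty)$ is such that for every $C>0$ there is $\gamma=\gamma(C)>0$ with $\lim_{n\to\infty}\frac{\exp\{CL^2(n)\}}{n^\gamma L(n)}=0$. Let $x\in\ell^{2\theta}_\rho(\mathbb Z^+)$ and let $(\tilde X^{(m_j),x})_j$ and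 $(\tilde X^{(n_j),x})_j$ be two sequences of finite-volume approximating processes, with $m_j\uparrow\infty$ and $n_j\uparrow\infty$. Then there exists a probability measure $\mathbf P^x$ on $\Omega_{Spin}$ such that, in the sense of weak convergence of probability measures on $\Omega_{Spin}$, $$\lim_{j\to\infty}\mathbb P\circ(\tilde X^{(m_j),x})^{-1}=\lim_{j\to\infty}\mathbb P\circ(\tilde X^{(n_j),x})^{-1}=\mathbf P^x .$$
   Context: $\mathbb Z^+=\{1,2,\dots\}$; $\ell^p_\rho(\mathbb Z^+)=\{x:\|x\|_{p,\rho}^p:=\sum_\gamma|x_\gamma|^p\rho(\gamma)<\infty\}$; $\Omega_{Spin}=C([0,\infty),\ell^2_\rho(\mathbb Z^+))$ with the topology of uniform convergence on compacts. Let $W_1$ be a one-dimensional Brownian motion on a probability space $(\Omega,\mathcal F,\mathbb P)$. For $n\in\mathbb N$, $X^{(n),x}$ is the unique solution of the finite-volume system $$dX^{(n)}_i(t)=\big(a_{i,i-1}X^{(n)}_{i-1}(t)+a_{i,i+1}X^{(n)}_{i+1}(t)+f(X^{(n)}_i(t))\big)dt+\mathbf 1_{\{i=1\}}dW_1(t),\quad X^{(n)}_i(0)=x_i,\quad 1\le i\le n,$$ with the conventions $a_{1,0}=0$, $X^{(n)}_0=X^{(n)}_{n+1}=0$. $\tilde X^{(n),x}=(X^{(n),x},0,0,\dots)$ is its extension by zero, viewed as an $\Omega_{Spin}$-valued random variable. *)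

(* Defs.v *)
From HB Require Import structures.
From mathcomp Require Import all_boot all_order all_algebra.
From mathcomp Require Import all_classical all_reals all_analysis.

Set Implicit Arguments.
Unset Strict Implicit.
Unset Printing Implicit Defensive.

Import Order.TTheory GRing.Theory Num.Theory.
Import numFieldNormedType.Exports.

Local Open Scope classical_set_scope.
Local Open Scope ring_scope.

(* A configuration on Z^+ = {1, 2, ...} is a function x : nat -> R with the
   boundary convention x 0 = 0; the value at 0 of a weight rho is never used. *)

Section weighted_ell.
Context {R : realType}.
Implicit Types (p : R) (rho : nat -> {posnum R}) (x : nat -> R).

Definition ell_sum p rho x : \bar R :=
  (\sum_(1 <= i <oo) (`|x i| `^ p * (rho i)%:num)%:E)%E.

Definition ell p rho : {pred nat -> R} :=
  [pred x : nat -> R | (x 0%N == 0) && (ell_sum p rho x < +oo)%E].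

Definition ell_norm p rho x : R := fine (ell_sum p rho x) `^ p^-1.

Lemma ell_sum_ge0 p rho x : (0 <= ell_sum p rho x)%E.
Proof. by apply: nneseries_ge0 => i _ _; rewrite lee_fin mulr_ge0 ?powR_ge0. Qed.

Lemma ell_sumE p rho x : 0 < p -> x 0%N = 0 ->
  ell_sum p rho x =
  (\sum_(0 <= i <oo) (`|(x i * (rho i)%:num `^ p^-1)%:E| `^ p))%E.
Proof.
move=> p0 x0.
have H i : (`|(x i * (rho i)%:num `^ p^-1)%:E| `^ p)%E =
    (`|x i| `^ p * (rho i)%:num)%:E.
  rewrite abse_EFin poweR_EFin normrM (ger0_norm (powR_ge0 _ _)).
  rewrite powRM ?powR_ge0 // -powRrM mulVf ?gt_eqF //.
  by rewrite powRr1.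
rewrite (eq_eseriesr (fun i _ => H i)).
rewrite [RHS](nneseries_split 0 1); last first.
  by move=> k _; rewrite lee_fin mulr_ge0 ?powR_ge0.
rewrite add0n big_nat1 x0 normr0 powR0 ?gt_eqF // mul0r add0e.
by [].
Qed.

Lemma ell_sum_Lnorm p rho x : 0 < p -> x 0%N = 0 ->
  (ell_sum p rho x `^ p^-1)%E =
  Lnorm counting p%:E (EFin \o (fun i => x i * (rho i)%:num `^ p^-1)).
Proof. by move=> p0 x0; rewrite Lnorm_counting // ell_sumE. Qed.

Lemma ell_Lnorm p rho x : 0 < p -> x \in ell p rho ->
  (ell_norm p rho x)%:E =
  Lnorm counting p%:E (EFin \o (fun i => x i * (rho i)%:num `^ p^-1)).
Proof.
move=> p0 /andP[/eqP x0 xoo]; rewrite -ell_sum_Lnorm // /ell_norm.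
have fx : ell_sum p rho x \is a fin_num by rewrite ge0_fin_numE // ell_sum_ge0.
by rewrite -poweR_EFin fineK.
Qed.

Lemma ell_triangle p rho x y : 1 <= p -> x 0%N = 0 -> y 0%N = 0 ->
  (ell_sum p rho (x + y)%R `^ p^-1 <=
   ell_sum p rho x `^ p^-1 + ell_sum p rho y `^ p^-1)%E.
Proof.
move=> p1 x0 y0; have p0 : 0 < p by apply: lt_le_trans p1.
rewrite !ell_sum_Lnorm //; last by rewrite fctE x0 y0 addr0.
have -> : (fun i => (x + y) i * (rho i)%:num `^ p^-1) =
   (fun i => x i * (rho i)%:num `^ p^-1) \+
   (fun i => y i * (rho i)%:num `^ p^-1).
  by apply/funext => i /=; rewrite fctE mulrDl.
exact: minkowski_EFin.
Qed.

Lemma ell_sumZ p rho (c : R) x :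
  ell_sum p rho (c *: x) = ((`|c| `^ p)%:E * ell_sum p rho x)%E.
Proof.
rewrite /ell_sum -nneseriesZl; last first.
  by move=> i _; rewrite lee_fin mulr_ge0 ?powR_ge0.
by apply: eq_eseriesr => i _; rewrite fctE normrM powRM // -mulrA EFinM.
Qed.

Lemma ell_submod_closed p rho : 1 <= p -> submod_closed (ell p rho).
Proof.
move=> p1; have p0 : 0 < p by apply: lt_le_trans p1.
have Z c x : x \in ell p rho -> c *: x \in ell p rho.
  move=> /andP[/eqP x0 xoo]; apply/andP; split.
    by rewrite fctE x0 scaler0.
  by rewrite ell_sumZ; apply: lte_mul_pinfty; rewrite ?lee_fin ?powR_ge0.
split=> [|c x y /(Z c) xl yl].
  rewrite inE eqxx /= /ell_sum eseries0 ?ltry // => i _ _.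
  by rewrite normr0 powR0 ?gt_eqF // mul0r.
move: (c *: x) xl => {}x /andP[/eqP x0 xoo]; move: yl => /andP[/eqP y0 yoo].
apply/andP; split; first by rewrite fctE x0 y0 addr0.
have := @ell_triangle p rho x y p1 x0 y0.
have lt z : (ell_sum p rho z < +oo -> ell_sum p rho z `^ p^-1 < +oo)%E.
  exact: poweR_lty.
move=> /le_lt_trans => /(_ +oo%E (lte_add_pinfty (lt _ xoo) (lt _ yoo))).
case: (ell_sum p rho (x + y)%R) => [r _|//=|//]; first exact: ltry.
by rewrite gt_eqF ?invr_gt0.
Qed.

Lemma ell_normE p rho x : 0 < p -> x \in ell p rho ->
  (ell_norm p rho x)%:E = (ell_sum p rho x `^ p^-1)%E.
Proof.
by move=> p0 xl; rewrite ell_Lnorm // ell_sum_Lnorm //; case/andP: xl => /eqP.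
Qed.

Lemma ell_normD p rho x y : 1 <= p -> x \in ell p rho -> y \in ell p rho ->
  ell_norm p rho (x + y) <= ell_norm p rho x + ell_norm p rho y.
Proof.
move=> p1 xl yl; have p0 : 0 < p by apply: lt_le_trans p1.
have [_ D] := ell_submod_closed rho p1.
have xyl : x + y \in ell p rho by have := D 1 x y xl yl; rewrite scale1r.
have x0 : x 0%N = 0 by case/andP: xl => /eqP.
have y0 : y 0%N = 0 by case/andP: yl => /eqP.
have := ell_triangle rho p1 x0 y0.
have Exy := ell_normE p0 xyl.
have Ex := ell_normE p0 xl.
have Ey := ell_normE p0 yl.
move: Exy Ex Ey.
move: (ell_norm _ _ _) (ell_norm _ _ _) (ell_norm _ _ _) => a b c.
by move=> <- <- <-; rewrite -EFinD lee_fin.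
Qed.

Lemma ell_normZ p rho (c : R) x : 0 < p -> x \in ell p rho ->
  ell_norm p rho (c *: x) = `|c| * ell_norm p rho x.
Proof.
move=> p0 /andP[_ xoo]; have s0 := ell_sum_ge0 p rho x.
rewrite /ell_norm ell_sumZ fineM //; last by rewrite ge0_fin_numE.
rewrite powRM ?powR_ge0 ?fine_ge0 // -powRrM mulfV ?gt_eqF //.
by rewrite powRr1.
Qed.

Lemma ell_norm0_eq0 p rho x : 0 < p -> x \in ell p rho ->
  ell_norm p rho x = 0 -> x = 0.
Proof.
move=> p0 /andP[/eqP x0 xoo] /eqP; have sge0 := ell_sum_ge0 p rho x.
rewrite powR_eq0 => /andP[/eqP s0 _].
have {xoo} {}s0 : ell_sum p rho x = 0%E.
  by rewrite -[LHS]fineK ?s0 // ge0_fin_numE.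
apply/funext => -[//|i].
have le : ((`|x i.+1| `^ p * (rho i.+1)%:num)%:E <= ell_sum p rho x)%E.
  have h k : (1 <= k)%N ->
      (0 <= (`|x k| `^ p * (rho k)%:num)%:E)%E.
    by move=> _; rewrite lee_fin mulr_ge0 ?powR_ge0.
  rewrite /ell_sum (@nneseries_split _ _ 1 i.+1 h) big_nat_recr //=.
  rewrite -addeA addeCA leeDl //; apply: adde_ge0.
    by apply: sume_ge0 => k _; rewrite lee_fin mulr_ge0 ?powR_ge0.
  by apply: nneseries_ge0 => k _ _; rewrite lee_fin mulr_ge0 ?powR_ge0.
move: le; rewrite s0 lee_fin pmulr_lle0 // => le.
have /eqP : `|x i.+1| `^ p = 0 by apply/eqP; rewrite eq_le le powR_ge0.
by rewrite powR_eq0 normr_eq0 => /andP[/eqP].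
Qed.

End weighted_ell.

Section ell2.
Context {R : realType} (rho : nat -> {posnum R}).

Record ell2 := Ell2 {
  ell2_seq :> nat -> R;
  ell2P : ell2_seq \in ell 2 rho }.

HB.instance Definition _ := [isSub for ell2_seq].
HB.instance Definition _ := [Choice of ell2 by <:].

Let ell2_submod_closed : submod_closed (ell 2 rho).
Proof. by apply: ell_submod_closed; rewrite ler1n. Qed.

HB.instance Definition _ :=
  GRing.isSubmodClosed.Build R (nat -> R) (ell 2 rho) ell2_submod_closed.
HB.instance Definition _ := [SubChoice_isSubLmodule of ell2 by <:].

Let norm (x : ell2) : R := ell_norm 2 rho x.

Let two_gt0 : 0 < 2 :> R. Proof. by rewrite ltr0n. Qed.

Let ell2D (x y : ell2) : ell2_seq (x + y) = ell2_seq x + ell2_seq y.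
Proof. exact: (raddfD (val : ell2 -> nat -> R)). Qed.

Let ell2Z (c : R) (x : ell2) : ell2_seq (c *: x) = c *: ell2_seq x.
Proof. exact: (linearZZ (val : ell2 -> nat -> R)). Qed.

Let ler_normD (x y : ell2) : norm (x + y) <= norm x + norm y.
Proof. by rewrite /norm ell2D ell_normD ?ell2P ?ler1n. Qed.

Let normrZ (c : R) (x : ell2) : norm (c *: x) = `|c| * norm x.
Proof. by rewrite /norm ell2Z ell_normZ ?ell2P. Qed.

Let normr0_eq0 (x : ell2) : norm x = 0 -> x = 0.
Proof. by move=> /(ell_norm0_eq0 two_gt0 (ell2P x)) x0; exact: val_inj. Qed.

HB.instance Definition _ :=
  @Lmodule_isNormed.Build R ell2 norm ler_normD normrZ normr0_eq0.

End ell2.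

(* Omega_Spin = C([0, oo), ell^2_rho(Z^+)) with the topology of uniform
   convergence on compact subsets of [0, oo). *)
Definition Rplus (R : realType) : topologicalType :=
  set_type [set t : R | 0 <= t].

Section path_space.
Context {R : realType} (rho : nat -> {posnum R}).

Definition Omega_Spin : Type := continuousType (Rplus R) (ell2 rho).

HB.instance Definition _ := Choice.on Omega_Spin.
HB.instance Definition _ := isPointed.Build Omega_Spin
  (cst 0 : continuousType (Rplus R) (ell2 rho)).
HB.instance Definition _ := Uniform.copy Omega_Spin
  (initial_topology
    (id : continuousType (Rplus R) (ell2 rho) ->
          {family compact, Rplus R -> ell2 rho})).

End path_space.

Notation borel T := (g_sigma_algebraType (@open T)).

Definition weak_cvg {R : realType} {T : ptopologicalType}
    (mu_ : nat -> probability (borel T) R) (mu : probability (borel T) R) :=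
  forall F : T -> R, continuous F -> (exists M, forall g, `|F g| <= M) ->
    \int[mu_ n]_g F g @[n --> \oo] --> \int[mu]_g F g.

Section brownian_motion.
Local Open Scope ereal_scope.
Context {R : realType} d {Omega : measurableType d} (P : probability Omega R).

Definition increment (W : R -> Omega -> R) (s t : R) : Omega -> R :=
  fun w => (W t w - W s w)%R.

(* Taking A k = setT recovers the product rule for sub-families of increments. *)
Definition brownian_motion (W : R -> {RV P >-> R}) : Prop :=
  [/\ {ae P, forall w, W 0%R w = 0%R},
      {ae P, forall w, {within [set t : R | (0 <= t)%R],
                          continuous (fun t => W t w)}},
      forall (s t : R) (A : set R), (0 <= s)%R -> (s < t)%R -> measurable A ->
        P (increment W s t @^-1` A) = normal_prob 0%R (Num.sqrt (t - s)) A &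
      forall (n : nat) (t : nat -> R) (A : nat -> set R),
        (0 <= t 0%N)%R -> {homo t : i j / (i <= j)%N >-> (i <= j)%R} ->
        (forall k, measurable (A k)) ->
        P (\bigcap_(k in `I_n) (increment W (t k) (t k.+1) @^-1` A k)) =
        \prod_(k < n) P (increment W (t k) (t k.+1) @^-1` A k)].

End brownian_motion.

Section finite_volume.
Context {R : realType} d {Omega : measurableType d} (P : probability Omega R).

(* X is indexed by site, then time.  The equation is the integrated form of the
   SDE: the noise is additive, so no stochastic integral is needed. *)
Definition finite_volume_solution (a : nat -> nat -> R) (f : R -> R)
    (W : R -> Omega -> R) (n : nat) (x : nat -> R)
    (X : nat -> R -> Omega -> R) : Prop :=
  [/\ forall t w, X 0%N t w = 0, forall t w, X n.+1 t w = 0,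
      forall i t, (1 <= i <= n)%N -> 0 <= t -> measurable_fun setT (X i t) &
      {ae P, forall w, forall i, (1 <= i <= n)%N ->
        {within [set t : R | 0 <= t], continuous (fun t => X i t w)} /\
        forall t, 0 <= t ->
          X i t w = x i
            + \int[lebesgue_measure]_(s in `[0, t])
                (a i i.-1 * X i.-1 s w + a i i.+1 * X i.+1 s w + f (X i s w))
            + (if i == 1%N then W t w else 0)}].

Definition zero_extension {rho : nat -> {posnum R}} (n : nat)
    (X : nat -> R -> Omega -> R) (Xt : Omega -> Omega_Spin rho) : Prop :=
  {ae P, forall w, forall (t : Rplus R) (i : nat),
    Xt w t i = if (1 <= i <= n)%N then X i (\val t) w else 0}.

End finite_volume.

Definition smooth {R : realType} (f : R -> R) : Prop :=
  forall (k : nat) (z : R), derivable (f^`(k))%classic z 1.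

(* Main.v *)
From HB Require Import structures.
Require Import Defs.
From mathcomp Require Import all_boot all_order all_algebra.
From mathcomp Require Import all_classical all_reals all_analysis.
From mathcomp Require Import measurable_realfun.
From mathcomp Require Import ring lra zify.

Import Order.TTheory GRing.Theory Num.Theory.
Import numFieldNormedType.Exports.
Local Open Scope classical_set_scope.
Local Open Scope ring_scope.

(** The noise is additive and drives a single site, so along a fixed noise path
    each finite-volume system is a deterministic integral equation.  The proof
    works path by path: for almost every sample point the extended processes
    converge in Omega_Spin as the volume runs through all integers.  The limit
    is a random variable, its law is the required measure, and every
    subsequence of volumes inherits the convergence of laws.

    A priori bound.  Dissipativity makes f push a site inwards as soon as
    its value exceeds 1 in absolute value.  Following a path back to the last
    time at which it was below this level, only the two neighbours and the
    oscillation of the noise can have made it grow ([excursion_norm_le]).  The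
    resulting linear inequality between neighbouring sites is compared with
    B i * exp (mu * t), where B is square summable for the weight rho, lies
    above the data, and changes by at most a constant factor from one site to
    the next ([weighted_slowly_varying_majorant], [barrier_bound]).  The bound
    does not depend on the volume.

    Cauchy property.  In the difference of the solutions in the volumes n <= m
    the noise cancels, and the same excursion argument, now at level 0, only
    uses one-sided Lipschitz bounds for f.  The difference enters at the site
    n + 1 and needs n + 1 - i Picard iterations to reach the site i, which
    costs a factor (nu * T) ^ (n + 1 - i) / (n + 1 - i)!
    ([difference_bound]).  Since B grows at most geometrically with the site,
    the relevant Lipschitz constants are L (k0 ^ n), and the growth condition
    on L makes them of order o(n): the factorial beats everything else
    ([sublinear_along_powers], [picard_error_cvg0], [path_solutions_cauchy]).

    Passage to laws.  The majorant B turns sitewise convergence into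
    convergence in norm, uniformly on bounded time intervals
    ([ell2_dominated_cvg], [Omega_Spin_dominated_cvg]).  Since the
    uniformity of Omega_Spin has a countable base, almost sure limits of random
    paths are measurable ([limit_measurable]), and almost sure convergence
    implies weak convergence by dominated convergence ([ae_cvg_weak_cvg]). *)

Set Implicit Arguments.
Unset Strict Implicit.
Unset Printing Implicit Defensive.

(** * Integral inequalities along excursions *)

Section integral_comparison.
Context {R : realType}.
Implicit Types (u p g h H : R -> R) (s t T c : R).

Lemma continuous_integrable g s t : continuous g ->
  lebesgue_measure.-integrable `[s, t] (EFin \o g).
Proof.
move=> cg; apply: continuous_compact_integrable; first exact: segment_compact.
exact: continuous_subspaceT.
Qed.

Let continuous_integrable_oc g s t : continuous g ->
  lebesgue_measure.-integrable `]s, t] (EFin \o g).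
Proof.
move=> cg; apply: integrableS (continuous_integrable s t cg).
- exact: measurable_itv.
- exact: measurable_itv.
- by move=> x /=; rewrite !in_itv/= => /andP[/ltW -> ->].
Qed.

Let Rintegral_itv_oc g s t : continuous g ->
  \int[lebesgue_measure]_(x in `]s, t]) g x =
  \int[lebesgue_measure]_(x in `[s, t]) g x.
Proof.
by move=> cg; apply: Rintegral_itv_obnd_cbnd; exact: continuous_integrable_oc.
Qed.

Lemma Rintegral_le_primitive g h H s t : s <= t ->
  continuous g -> continuous h -> (forall x : R, is_derive x 1 H (h x)) ->
  (forall x, s < x <= t -> g x <= h x) ->
  \int[lebesgue_measure]_(x in `[s, t]) g x <= H t - H s.
Proof.
rewrite le_eqVlt => /predU1P[-> *|st cg ch dH gh].
  by rewrite subrr set_itv1 Rintegral_set1.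
have -> : H t - H s = \int[lebesgue_measure]_(x in `[s, t]) h x.
  have -> // : \int[lebesgue_measure]_(x in `[s, t]) h x
      = fine ((H t)%:E - (H s)%:E)%E.
  rewrite /Rintegral; congr fine; apply: continuous_FTC2 => //.
  - exact: continuous_subspaceT.
  - have cH : continuous H.
      move=> x; apply: differentiable_continuous; apply/derivable1_diffP.
      by case: (dH x).
    split=> [x _||].
    + by case: (dH x).
    + by apply: cvg_at_right_filter; exact: cH.
    + by apply: cvg_at_left_filter; exact: cH.
  - by move=> x _; rewrite derive1E; have := dH x => -[].
rewrite -!Rintegral_itv_oc //.
apply: le_Rintegral => //.
- exact: continuous_integrable_oc.
- exact: continuous_integrable_oc.
Qed.

(** The path u is followed back from time t to the last time at which it was at
    most c (or to time 0).  In between, the drift g is dominated by h, whose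
    primitive is H; the forcing p contributes its oscillation, hence the
    factor 2. *)
Lemma excursion_le T u p g h H c pb : 0 <= c ->
  continuous u -> continuous g -> continuous h ->
  (forall x : R, is_derive x 1 H (h x)) ->
  (forall x y : R, 0 <= x -> x <= y -> H x <= H y) ->
  (forall t, 0 <= t <= T ->
     u t = p t + \int[lebesgue_measure]_(x in `[0, t]) g x) ->
  (forall t, 0 <= t <= T -> `|p t| <= pb) ->
  (forall t, 0 <= t <= T -> c < u t -> g t <= h t) ->
  forall t, 0 <= t <= T -> u t <= c + 2 * pb + (H t - H 0).
Proof.
move=> c0 cu cg ch dH mH eu bp gh t /andP[t0 tT].
have pb0 : 0 <= pb.
  by apply: le_trans (bp t _); [exact: normr_ge0|rewrite t0].
have H0 : 0 <= H t - H 0 by rewrite subr_ge0 mH.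
have [utc|cut] := leP (u t) c; first by rewrite -addrA; lra.
(* A is compact, so it contains a last time s unless it is empty. *)
pose A := `[0, t]%classic `&` u @^-1` [set x | x <= c].
have [A0|/set0P A0] := eqVneq A set0.
  rewrite eu ?t0 //; apply: lerD; last first.
    apply: Rintegral_le_primitive => // x /andP[x0 xt].
    have x0T : 0 <= x <= T by rewrite (ltW x0) (le_trans xt).
    apply: gh => //; rewrite ltNge; apply/negP => uxc.
    suff : A x by rewrite A0.
    by split => //=; rewrite in_itv/= (ltW x0).
  have t0T : 0 <= t <= T by rewrite t0.
  have := ler_norm (p t); have := bp _ t0T; lra.
have cA : compact A.
  apply: compact_closedI; first exact: segment_compact.
  by apply: closed_comp => [x _|]; [exact: cu|exact: closed_le].
have [s] := compact_EVT_max A0 cA (continuous_subspaceT (fun x : R => @cvg_id _ (nbhs x))).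
rewrite inE => -[]/=; rewrite in_itv/= => /andP[s0 st] usc smax.
have st' : s < t.
  by rewrite lt_neqAle st andbT; apply: contraTneq usc => ->; rewrite -ltNge.
have -> : u t = u s + (p t - p s)
     + \int[lebesgue_measure]_(x in `[s, t]) g x.
  rewrite !eu ?s0 ?t0 ?(le_trans st)//.
  rewrite -(@Rintegral_itv_oc g s t) //.
  rewrite -(@Rintegral_itvB _ _ (BLeft 0) (BRight t) s) ?bnd_simp//.
    by ring.
  exact: continuous_integrable.
have I : \int[lebesgue_measure]_(x in `[s, t]) g x <= H t - H s.
  apply: Rintegral_le_primitive => // x /andP[sx xt].
  have x0 := le_trans s0 (ltW sx).
  apply: gh; first by rewrite x0 (le_trans xt).
  rewrite ltNge; apply/negP => uxc.
  suff /smax : x \in A by rewrite leNgt sx.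
  by rewrite inE; split => //=; rewrite in_itv/= x0.
have Hs : H 0 <= H s by exact: mH.
have Ps : `|p s| <= pb by apply: bp; rewrite s0 (le_trans st).
have Pt : `|p t| <= pb by apply: bp; rewrite t0.
move: Ps Pt; rewrite !ler_norml => /andP[? ?] /andP[? ?]; lra.
Qed.

Lemma excursion_norm_le T u p g h H c pb : 0 <= c ->
  continuous u -> continuous g -> continuous h ->
  (forall x : R, is_derive x 1 H (h x)) ->
  (forall x y : R, 0 <= x -> x <= y -> H x <= H y) ->
  (forall t, 0 <= t <= T ->
     u t = p t + \int[lebesgue_measure]_(x in `[0, t]) g x) ->
  (forall t, 0 <= t <= T -> `|p t| <= pb) ->
  (forall t, 0 <= t <= T -> c < u t -> g t <= h t) ->
  (forall t, 0 <= t <= T -> u t < - c -> - h t <= g t) ->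
  forall t, 0 <= t <= T -> `|u t| <= c + 2 * pb + (H t - H 0).
Proof.
move=> c0 cu cg ch dH mH eu bp gh gh' t tT.
rewrite ler_norml lerNl; apply/andP; split; last exact: (@excursion_le T u p g h H c pb).
apply: (@excursion_le T (- u) (- p) (- g) h H c pb) => //.
- by move=> x; apply: cvgN; exact: cu.
- by move=> x; apply: cvgN; exact: cg.
- move=> s sT; rewrite !fctE eu // opprD; congr (_ + _).
  rewrite -mulN1r -RintegralZl //; last exact: continuous_integrable.
  by apply: eq_Rintegral => x _; rewrite mulN1r.
- by move=> s sT; rewrite fctE normrN; exact: bp.
- by move=> s sT; rewrite !fctE ltrNr lerNl; exact: gh'.
Qed.

End integral_comparison.

(** * The system driven by a fixed path *)

Section deterministic_system.
Context {R : realType}.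
Variables (a : nat -> nat -> R) (f : R -> R) (w : R -> R) (x : nat -> R).
Implicit Types (Y Z : nat -> R -> R) (n m i k : nat) (s t T : R).

Definition drift Y i s :=
  a i i.-1 * Y i.-1 s + a i i.+1 * Y i.+1 s + f (Y i s).

(** The integrated finite-volume system driven by one fixed path w; the paths
    live on the whole line so that continuity needs no restriction to [0, oo). *)
Definition path_solution n Y : Prop :=
  [/\ forall t, Y 0%N t = 0, forall t, Y n.+1 t = 0,
      forall i, (1 <= i <= n)%N -> continuous (Y i) &
      forall i t, (1 <= i <= n)%N -> 0 <= t ->
        Y i t = x i + (if i == 1%N then w t else 0)
          + \int[lebesgue_measure]_(s in `[0, t]) drift Y i s].

Hypothesis cf : continuous f.

Lemma path_solution_continuous n Y i : path_solution n Y -> (i <= n.+1)%N ->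
  continuous (Y i).
Proof.
move=> [Y0 Yn cY _]; case: i => [_|i].
  by rewrite (_ : Y 0%N = cst 0); [exact: cst_continuous|apply/funext].
rewrite ltnS leq_eqVlt => /predU1P[->|ilen]; last by apply: cY.
by rewrite (_ : Y n.+1 = cst 0); [exact: cst_continuous|apply/funext].
Qed.

Lemma drift_continuous n Y i : path_solution n Y -> (1 <= i <= n)%N ->
  continuous (drift Y i).
Proof.
move=> sY /andP[i1 ilen] s.
have cY j : (j <= n.+1)%N -> Y j r @[r --> s] --> Y j s.
  by move=> jn; exact: (path_solution_continuous sY jn).
apply: cvgD; first apply: cvgD.
- by apply: cvgM; [exact: cvg_cst|apply: cY; lia].
- by apply: cvgM; [exact: cvg_cst|apply: cY; lia].
- by apply: continuous_comp; [apply: cY; lia|exact: cf].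
Qed.

Variable (M : R).
Hypothesis M_gt0 : 0 < M.
Hypothesis aM : forall i, (1 <= i)%N -> `|a i i.-1| <= M /\ `|a i i.+1| <= M.

Section barrier.
Variables (eta T wbar kappa : R) (B : nat -> R).
Hypothesis eta_ge0 : 0 <= eta.
Hypothesis f_le : forall z, 1 < z -> f z <= eta.
Hypothesis f_ge : forall z, z < -1 -> - eta <= f z.
Hypothesis w_le : forall t, 0 <= t <= T -> `|w t| <= wbar.
Hypothesis kappa_gt0 : 0 < kappa.
Hypothesis Bk : forall i, (1 <= i)%N -> B i.+1 <= kappa * B i /\ B i <= kappa * B i.+1.
Hypothesis B_ge : forall i, (1 <= i)%N ->
  1 + 2 * (`|x i| + wbar) + eta * T <= B i.

(** A bound by q times the barrier improves to a bound by 1 + q / 2 times the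
    barrier.  The rate 4 * M * kappa makes the contribution of the two
    neighbours, at most 2 * M * kappa * q times the barrier, integrate to
    q / 2 times the barrier. *)
Lemma barrier_step n Y (q : R) : 0 <= q -> path_solution n Y ->
  (forall i t, (1 <= i <= n)%N -> 0 <= t <= T ->
     `|Y i t| <= q * (B i * expR (4 * M * kappa * t))) ->
  forall i t, (1 <= i <= n)%N -> 0 <= t <= T ->
     `|Y i t| <= (1 + q / 2) * (B i * expR (4 * M * kappa * t)).
Proof.
move=> q0 sY Yq i t iln /[dup] t0T /andP[t0 tT].
have wb0 : 0 <= wbar by apply: le_trans (w_le t0T); exact: normr_ge0.
have B0 j : (1 <= j)%N -> 0 <= B j.
  move=> j1; apply: le_trans (B_ge j1); have := normr_ge0 (x j).
  have : 0 <= eta * T by rewrite mulr_ge0 // (le_trans t0).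
  lra.
have [Y0 Yn cY eY] := sY.
have i1 : (1 <= i)%N by case/andP: iln.
set mu := 4 * M * kappa in Yq *.
pose H s := eta * s + q / 2 * (B i * expR (mu * s)).
pose h s := eta + 2 * M * (q * (kappa * B i * expR (mu * s))).
have Yq' j s : (1 <= j <= n.+1)%N -> 0 <= s <= T ->
    `|Y j s| <= q * (B j * expR (mu * s)).
  move=> /andP[j1 jn] sT; have [jn'|nj] := leqP j n.
    by apply: Yq => //; rewrite j1.
  have -> : j = n.+1 by apply/eqP; rewrite eqn_leq jn.
  by rewrite Yn normr0 mulr_ge0 // mulr_ge0 ?expR_ge0 ?B0.
have nb s : 0 <= s <= T ->
    `|a i i.-1 * Y i.-1 s + a i i.+1 * Y i.+1 s|
      <= 2 * M * (q * (kappa * B i * expR (mu * s))).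
  move=> sT; apply: le_trans (ler_normD _ _) _; rewrite !normrM.
  have [aM1 aM2] := aM i1; have [Bk1 _] := Bk i1.
  have -> : 2 * M * (q * (kappa * B i * expR (mu * s))) =
    M * (q * (kappa * B i * expR (mu * s))) +
    M * (q * (kappa * B i * expR (mu * s))) by ring.
  apply: lerD; apply: ler_pM => //.
  - case: (i) iln => [//|[|j]] jn /=.
      rewrite Y0 normr0 !mulr_ge0 ?expR_ge0 ?B0 //; exact: ltW.
    apply: le_trans (Yq' _ _ _ sT) _; first by move: jn; clear; lia.
    apply: ler_wpM2l => //; apply: ler_wpM2r; first exact: expR_ge0.
    by have [] := @Bk j.+1 isT.
  - apply: le_trans (Yq' _ _ _ sT) _; first by move: iln; clear; lia.
    by apply: ler_wpM2l => //; apply: ler_wpM2r; first exact: expR_ge0.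
have emu s r : s <= r -> expR (mu * s) <= expR (mu * r).
  by move=> sr; rewrite ler_expR ler_wpM2l // /mu !mulr_ge0 // ltW.
have key : `|Y i t| <= 1 + 2 * (`|x i| + wbar) + (H t - H 0).
  apply: (@excursion_norm_le _ T (Y i)
      (fun t => x i + (if i == 1%N then w t else 0)) (drift Y i) h H) => //.
  - exact: cY.
  - exact: drift_continuous sY iln.
  - move=> s; rewrite /h; apply: cvgD; first exact: cvg_cst.
    apply: cvgM; first exact: cvg_cst.
    apply: cvgM; first exact: cvg_cst.
    apply: cvgM; first exact: cvg_cst.
    apply: continuous_comp; last exact: continuous_expR.
    by apply: cvgM; [exact: cvg_cst|exact: cvg_id].
  - move=> s; rewrite /H /h; apply: is_derive_eq.
    by rewrite /mu /GRing.scale /=; field.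
  - move=> s r _ sr; rewrite /H; apply: lerD; first by rewrite ler_wpM2l.
    by rewrite !ler_wpM2l ?B0 ?divr_ge0 ?emu.
  - by move=> s /andP[s0 _]; exact: eY.
  - move=> s sT; apply: le_trans (ler_normD _ _) _; rewrite lerD2l.
    by case: ifP => _; [exact: w_le|rewrite normr0].
  - move=> s sT Ys; rewrite /drift /h addrC lerD ?f_le //.
    by apply: le_trans (nb _ sT); exact: ler_norm.
  - move=> s sT Ys; rewrite /drift /h opprD addrC lerD ?f_ge //.
    by have := nb _ sT; rewrite ler_norml => /andP[].
apply: le_trans key _; rewrite /H mulr0 add0r mulr0 expR0 mulr1.
have E1 : 1 <= expR (mu * t) by rewrite -expR0 -(mulr0 mu) emu.
have Bi := B_ge i1; have Bi0 := B0 _ i1.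
have et : eta * t <= eta * T by rewrite ler_wpM2l.
have qB : 0 <= q / 2 * B i by rewrite mulr_ge0 // divr_ge0.
have BE : B i <= B i * expR (mu * t) by rewrite ler_peMr.
by rewrite mulrDl mul1r; lra.
Qed.

(** The finitely many continuous coordinates satisfy the bound for some q, and
    iterating q -> 1 + q / 2 drives q to the fixed point 2, which no longer
    depends on n nor on the solution. *)
Lemma barrier_bound n Y : path_solution n Y ->
  forall i t, (1 <= i <= n)%N -> 0 <= t <= T ->
    `|Y i t| <= 2 * (B i * expR (4 * M * kappa * t)).
Proof.
move=> sY i t iln t0T; have [Y0 Yn cY eY] := sY.
have /andP[t0 tT] := t0T.
have T0 := le_trans t0 tT.
have wb0 : 0 <= wbar by apply: le_trans (w_le t0T); exact: normr_ge0.
have B1 j : (1 <= j)%N -> 1 <= B j.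
  move=> j1; apply: le_trans (B_ge j1); have := normr_ge0 (x j).
  have : 0 <= eta * T by rewrite mulr_ge0.
  lra.
have E1 s : 0 <= s -> 1 <= expR (4 * M * kappa * s).
  by move=> s0; rewrite -expR0 ler_expR !mulr_ge0 // ltW.
have [q [q0 Yq]] : exists q, 0 <= q /\
    forall i t, (1 <= i <= n)%N -> 0 <= t <= T ->
     `|Y i t| <= q * (B i * expR (4 * M * kappa * t)).
  have bY j : exists q, 0 <= q /\ ((1 <= j <= n)%N ->
      forall s, 0 <= s <= T -> `|Y j s| <= q).
    have [jn|] := boolP (1 <= j <= n)%N; last by exists 0.
    have [c _ cmax] := @EVT_max R (fun s => `|Y j s|) 0 T T0
      (continuous_subspaceT (fun s => continuous_comp (cY _ jn s) (@norm_continuous _ _ _))).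
    exists `|Y j c|; split=> [//|_ s sT]; apply: cmax.
    by rewrite in_itv.
  have [q qP] := choice bY.
  exists (\sum_(j < n.+1) q j); split; first by apply: sumr_ge0 => j _; case: (qP j).
  move=> j s jn sT; have [q0 /(_ jn _ sT) Yq] := qP j.
  apply: le_trans Yq _; have jn1 : (j < n.+1)%N by case/andP: jn.
  apply: (@le_trans _ _ (\sum_(j < n.+1) q j)).
    rewrite (bigD1 (Ordinal jn1)) //= lerDl; apply: sumr_ge0 => l _.
    by case: (qP l).
  rewrite ler_peMr //; first by apply: sumr_ge0 => l _; case: (qP l).
  have /andP[s0 _] := sT; have /andP[j1 _] := jn.
  by have := B1 _ j1; have := E1 _ s0; nra.
(* The k-th iterate of q -> 1 + q / 2 is at most C k. *)
pose C k : R := 2 + q / 2 ^+ k.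
have Ck k : forall i t, (1 <= i <= n)%N -> 0 <= t <= T ->
     `|Y i t| <= C k * (B i * expR (4 * M * kappa * t)).
  elim: k => [|k IH] j s jn sT.
    apply: le_trans (Yq _ _ jn sT) _; rewrite /C expr0 divr1 [leRHS]mulrDl lerDr.
    have /andP[s0 _] := sT; have /andP[j1 _] := jn.
    by rewrite !mulr_ge0 ?expR_ge0 // (le_trans _ (B1 _ j1)).
  have C0 : 0 <= C k by rewrite addr_ge0 // divr_ge0 // exprn_ge0.
  have := barrier_step C0 sY IH jn sT; congr (_ <= _ * _).
  by rewrite /C exprS; field; rewrite expf_neq0.
have cvgC : C k * (B i * expR (4 * M * kappa * t)) @[k --> \oo] -->
    2 * (B i * expR (4 * M * kappa * t)).
  apply: cvgM; last exact: cvg_cst.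
  rewrite -[X in _ --> X]addr0; apply: cvgD; first exact: cvg_cst.
  rewrite -[X in _ --> X](mulr0 q); apply: cvgM; first exact: cvg_cst.
  under eq_fun do rewrite -exprVn.
  by apply: cvg_expr; rewrite ger0_norm ?invr_ge0 // invf_lt1 // ltr1n.
rewrite -(cvg_lim _ cvgC) //; apply: limr_ge; first by apply/cvg_ex; eexists; exact: cvgC.
by near=> k; exact: Ck.
Unshelve. all: end_near. Qed.

End barrier.

(** The two solutions differ only because the smaller volume imposes the value 0
    at the site n + 1.  Each Picard step consumes one site of distance to that
    boundary, so k steps are available at every site i with i + k <= n + 1.
    G bounds the difference where nothing better is known. *)
Lemma difference_bound T n m Y Z (beta : nat -> R) (Lam G : R) :
  (n <= m)%N -> path_solution n Y -> path_solution m Z -> 0 <= Lam ->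
  (forall i, (1 <= i)%N -> 0 <= beta i) ->
  (forall i t, (1 <= i <= n)%N -> 0 <= t <= T -> `|Y i t| <= beta i) ->
  (forall i t, (1 <= i <= m)%N -> 0 <= t <= T -> `|Z i t| <= beta i) ->
  (forall i, (1 <= i <= n.+1)%N -> 2 * beta i <= G) ->
  (forall i (y z : R), (1 <= i <= n)%N -> `|y| <= beta i -> `|z| <= beta i ->
     z <= y -> f y - f z <= Lam * (y - z)) ->
  forall k i t, (i + k <= n.+1)%N -> 0 <= t <= T ->
    `|Y i t - Z i t| <= G * (((Lam + 2 * M) * t) ^+ k / k`!%:R).
Proof.
move=> nm sY sZ Lam0 beta0 Yb Zb bG fL.
have [Y0 Yn cY eY] := sY; have [Z0 Zm cZ eZ] := sZ.
have G0 : 0 <= G by apply: le_trans (bG 1%N isT); rewrite mulr_ge0 ?beta0.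
have Lam20 : 0 <= Lam + 2 * M by rewrite addr_ge0 // mulr_ge0 // ltW.
elim=> [|k IH] i t ik t0T.
  rewrite expr0 fact0 divr1 mulr1; rewrite addn0 in ik.
  case: i ik => [_|i iln]; first by rewrite Y0 Z0 subrr normr0.
  apply: le_trans _ (bG i.+1 iln); apply: le_trans (ler_normB _ _) _.
  have -> : 2 * beta i.+1 = beta i.+1 + beta i.+1 by ring.
  apply: lerD.
    have [iln'|] := leqP i.+1 n; first exact: Yb.
    rewrite ltnS => ni; have -> : i = n by apply/eqP; rewrite eqn_leq ni andbT.
    by rewrite Yn normr0 beta0.
  have [ilm'|] := leqP i.+1 m; first exact: Zb.
  rewrite ltnS => mi; have -> : i = m.
    by apply/eqP; rewrite eqn_leq mi andbT (leq_trans _ nm).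
  by rewrite Zm normr0 beta0.
have [t0 tT] := andP t0T.
case: i ik => [_|i ik].
  rewrite Y0 Z0 subrr normr0 mulr_ge0 // divr_ge0 // exprn_ge0 //.
  by rewrite mulr_ge0.
have iln : (1 <= i.+1 <= n)%N by move: ik; clear; lia.
have ilm : (1 <= i.+1 <= m)%N by move: iln nm; clear; lia.
set nu := Lam + 2 * M in IH Lam20 *.
pose H s := G * ((nu * s) ^+ k.+1 / k.+1`!%:R).
pose h s := nu * (G * ((nu * s) ^+ k / k`!%:R)).
pose D j s := Y j s - Z j s.
have nb s : 0 <= s <= T ->
    `|a i.+1 i * D i s + a i.+1 i.+2 * D i.+2 s|
      <= 2 * M * (G * ((nu * s) ^+ k / k`!%:R)).
  move=> sT; apply: le_trans (ler_normD _ _) _; rewrite !normrM.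
  have [aM1 aM2] := aM (ltn0Sn i).
  rewrite -mulrA mulrDl mul1r; apply: lerD; apply: ler_pM => //.
  - by apply: IH => //; move: ik; clear; lia.
  - by apply: IH => //; move: ik; clear; lia.
have dD s : drift Y i.+1 s - drift Z i.+1 s =
    (a i.+1 i * D i s + a i.+1 i.+2 * D i.+2 s) + (f (Y i.+1 s) - f (Z i.+1 s)).
  by rewrite /drift /D /=; ring.
suff : `|Y i.+1 t - Z i.+1 t| <= 0 + 2 * 0 + (H t - H 0).
  by rewrite mulr0 !add0r /H mulr0 expr0n /= mul0r mulr0 subr0.
apply: (@excursion_norm_le _ T (fun t => Y i.+1 t - Z i.+1 t) (fun=> 0)
  (fun t => drift Y i.+1 t - drift Z i.+1 t) h H) => //.
- by move=> s; apply: cvgB; [exact: cY|exact: cZ].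
- move=> s; apply: cvgB.
    exact: (drift_continuous sY iln).
  exact: (drift_continuous sZ ilm).
- move=> s; apply: cvgM; first exact: cvg_cst.
  apply: cvgM; first exact: cvg_cst.
  apply: cvgM; last exact: cvg_cst.
  apply: (@continuous_comp _ _ _ (fun s => nu * s) (fun z => z ^+ k)).
    by apply: cvgM; [exact: cvg_cst|exact: cvg_id].
  exact: exprn_continuous.
- move=> s; pose C := G * nu ^+ k.+1 / k.+1`!%:R.
  have -> : H = C *: ((id : R -> R) ^+ k.+1).
    by apply/funext => r; rewrite /H /C scalrfctE exprfctE exprMn /GRing.scale /=; ring.
  apply: is_derive_eq; rewrite /h /C /GRing.scale /= factS natrM exprMn exprS.
  rewrite -[in LHS]mulr_natr mulr1; field.
  by rewrite nat1r !pnatr_eq0 -lt0n fact_gt0.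
- move=> s r s0 sr; rewrite /H ler_wpM2l // ler_wpM2r ?invr_ge0 //.
  have r0 := le_trans s0 sr.
  by apply: lerXn2r; rewrite ?nnegrE ?mulr_ge0 // ler_wpM2l.
- move=> s /andP[s0 _]; rewrite eY // eZ // opprD addrACA subrr; congr (_ + _).
  rewrite RintegralB //; apply: continuous_integrable.
    exact: (drift_continuous sY iln).
  exact: (drift_continuous sZ ilm).
- by move=> s _; rewrite normr0.
- move=> s sT Ds; rewrite dD /h.
  have -> : nu * (G * ((nu * s) ^+ k / k`!%:R)) =
    2 * M * (G * ((nu * s) ^+ k / k`!%:R)) + Lam * (G * ((nu * s) ^+ k / k`!%:R)).
    by rewrite /nu; ring.
  apply: lerD; first by apply: le_trans (nb _ sT); exact: ler_norm.
  apply: le_trans (fL i.+1 _ _ iln (Yb _ _ iln sT) (Zb _ _ ilm sT) _) _.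
    by rewrite -subr_ge0 ltW.
  apply: ler_wpM2l => //; apply: le_trans (ler_norm _) _.
  by apply: IH => //; move: ik; clear; lia.
- move=> s sT; rewrite oppr0 => Ds; rewrite dD /h.
  have -> : - (nu * (G * ((nu * s) ^+ k / k`!%:R))) =
    - (2 * M * (G * ((nu * s) ^+ k / k`!%:R))) - Lam * (G * ((nu * s) ^+ k / k`!%:R)).
    by rewrite /nu; ring.
  apply: lerD.
    by have := nb _ sT; rewrite ler_norml => /andP[].
  rewrite lerNl opprB.
  apply: le_trans (fL i.+1 _ _ iln (Zb _ _ ilm sT) (Yb _ _ iln sT) _) _.
    by rewrite -subr_le0 ltW.
  apply: ler_wpM2l => //; rewrite -opprB; apply: le_trans (ler_norm _) _.
  by rewrite normrN; apply: IH => //; move: ik; clear; lia.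
Qed.

End deterministic_system.

(** * Slowly varying majorants and growth estimates *)

Section smoothing.
Context {R : realType}.

(* ker i j is 2 to the power minus the distance of i and j. *)
Let ker (i j : nat) : R := 2^-1 ^+ ((i - j) + (j - i)).

Let ker_ge0 i j : 0 <= ker i j.
Proof. by rewrite exprn_ge0 // invr_ge0. Qed.

Let sum_ker n j : \sum_(i < n) ker i j <= 3 - 2^-1 ^+ j.
Proof.
elim: j n => [|j IH] n.
  have -> : \sum_(i < n) ker i 0 = 2 - 2 * 2^-1 ^+ n.
    elim: n => [|n IHn]; first by rewrite big_ord0 expr0; lra.
    by rewrite big_ord_recr /= IHn /ker subn0 sub0n addn0 exprS; lra.
  rewrite expr0; have : 0 <= 2^-1 ^+ n :> R by rewrite exprn_ge0 // invr_ge0.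
  lra.
case: n => [|n].
  rewrite big_ord0 subr_ge0 (@le_trans _ _ 1) ?ler1n //.
  by rewrite exprn_ile1 // ?invr_ge0 // invf_le1 // ler1n.
rewrite big_ord_recl /= {1}/ker sub0n subn0 add0n.
under eq_bigr do rewrite /ker /bump /= add1n !subSS.
have := IH n; rewrite exprS /ker; lra.
Qed.

(** The majorant is the convolution of s with 2 ^ (- |i - j|): the kernel changes
    by a factor at most 2 when i moves by one, and its total mass is at most 3,
    so that summability survives. *)
Lemma slowly_varying_majorant (s : nat -> R) : (forall i, 0 <= s i) ->
  (\sum_(0 <= i <oo) (s i)%:E < +oo)%E ->
  exists sg : nat -> R,
    [/\ forall i, s i <= sg i,
        forall i, sg i.+1 <= 2 * sg i /\ sg i <= 2 * sg i.+1 &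
        (\sum_(0 <= i <oo) (sg i)%:E < +oo)%E].
Proof.
move=> s0 soo.
have ks0 i j : (0 <= (ker i j * s j)%:E)%E by rewrite lee_fin mulr_ge0.
pose S i := (\sum_(0 <= j <oo) (ker i j * s j)%:E)%E.
have S0 i : (0 <= S i)%E by apply: nneseries_ge0 => j _ _; exact: ks0.
have ker1 i j : ker i j <= 1.
  by rewrite exprn_ile1 // ?invr_ge0 // invf_le1 // ler1n.
have Sfin i : S i \is a fin_num.
  rewrite ge0_fin_numE //; apply: le_lt_trans soo.
  apply: lee_nneseries => [j *|j _]; first exact: ks0.
  by rewrite lee_fin ler_piMl.
have dbl i i' : (forall j, ker i j <= 2 * ker i' j) -> fine (S i) <= 2 * fine (S i').
  move=> h; rewrite -lee_fin EFinM !fineK // /S -nneseriesZl; last first.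
    by move=> j _; exact: ks0.
  apply: lee_nneseries => [j *|j _]; first exact: ks0.
  by rewrite -EFinM lee_fin mulrA ler_wpM2r.
have ker2 i j e : (e <= (i - j) + (j - i) + 1)%N ->
    ker i j <= 2 * 2^-1 ^+ e.
  move=> le; rewrite (@le_trans _ _ (2 * 2^-1 ^+ ((i - j) + (j - i) + 1))) //.
    by rewrite addn1 exprS mulrA mulfV ?pnatr_eq0 // mul1r.
  by rewrite ler_wpM2l // ler_wiXn2l // ?invr_ge0 // invf_le1 // ler1n.
exists (fun i => fine (S i)); split.
- move=> i; rewrite -lee_fin fineK //.
  have -> : (s i)%:E = (\sum_(i <= j < i.+1) (ker i j * s j)%:E)%E.
    by rewrite big_nat1 /ker subnn expr0 mul1r.
  apply: le_trans (nneseries_lim_ge i.+1 _); last by move=> j _ _; exact: ks0.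
  rewrite (@big_cat_nat _ _ _ i 0 i.+1) //= leeDr //.
  by apply: sume_ge0 => j _; exact: ks0.
- move=> i; split; apply: dbl => j; apply: ker2; clear; lia.
- under eq_eseriesr do rewrite fineK //.
  rewrite /S nneseries_interchange //.
  have : (3%:E * \sum_(0 <= i <oo) (s i)%:E < +oo)%E.
    by rewrite lte_mul_pinfty // lee_fin.
  apply: le_lt_trans; rewrite -nneseriesZl; last by move=> j _; rewrite lee_fin.
  apply: lee_nneseries => [j *|j _]; first exact: nneseries_ge0.
  apply: lime_le; first by apply: is_cvg_nneseries => ? _ _; exact: ks0.
  near=> n; rewrite sumEFin -EFinM lee_fin -mulr_suml ler_wpM2r // big_mkord.
  apply: le_trans (sum_ker _ _) _; rewrite gerBl exprn_ge0 // invr_ge0 //.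
Unshelve. all: end_near. Qed.

End smoothing.

Section growth.
Context {R : realType}.

(** The growth condition with C = 1 gives exp (L n ^ 2 / 2) <= n ^ gam, because
    l <= exp (l ^ 2 / 2).  Hence L n ^ 2 <= 2 * gam * ln n, and along powers of
    k0 the square of L is at most linear.  Completing a square turns this into
    an arbitrarily small linear slope for L itself. *)
Lemma sublinear_along_powers (L : nat -> R) (gam : R) (k0 : nat) :
  (2 <= k0)%N -> (forall n, 0 < L n) -> 0 < gam ->
  expR (L n ^+ 2) / (n%:R `^ gam * L n) @[n --> \oo] --> (0 : R) ->
  forall dlt : R, 0 < dlt ->
  exists C : R, \forall n \near \oo, L (k0 ^ n)%N <= dlt * n%:R + C.
Proof.
move=> k02 L0 gam0 cvgL dlt dlt0.
have k0n : (k0 ^ n)%N @[n --> \oo] --> \oo.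
  apply/cvgnyPge => A; near=> n.
  apply: leq_trans (_ : n <= _)%N; first by near: n; exact: nbhs_infty_ge.
  by apply: ltnW; apply: ltn_expl.
have /cvgrPdist_lt /(_ 1 ltr01) := cvg_comp _ _ k0n cvgL.
set lk := ln (k0%:R : R) => ev.
have lk0 : 0 < lk by apply: ln_gt0; rewrite ltr1n.
set e := dlt / (2 * gam * lk).
have g0 : 0 < 2 * gam * lk by rewrite !mulr_gt0.
have e0 : 0 < e by rewrite divr_gt0.
exists (1 / (4 * e)); near=> n.
have : `|0 - expR (L (k0 ^ n)%N ^+ 2) / ((k0 ^ n)%:R `^ gam * L (k0 ^ n)%N)| < 1.
  by near: n; exact: ev.
set l := L (k0 ^ n)%N; have l0 : 0 < l by exact: L0.
have kn0 : 0 < (k0 ^ n)%:R :> R by rewrite ltr0n expn_gt0; apply/orP; left; lia.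
rewrite sub0r normrN ger0_norm; last first.
  by rewrite divr_ge0 ?expR_ge0 // mulr_ge0 ?powR_ge0 // ltW.
rewrite ltr_pdivrMr ?mulr_gt0 ?powR_gt0 // => lt1.
have ll : l <= expR (l ^+ 2 / 2).
  by apply: le_trans (expR_ge1Dx _); nra.
have : expR (l ^+ 2) <= (k0 ^ n)%:R `^ gam * expR (l ^+ 2 / 2).
  by apply: le_trans (ltW lt1) _; rewrite mul1r ler_wpM2l ?powR_ge0.
rewrite /powR gt_eqF // natrX lnXn ?ltr0n; last lia.
rewrite -expRD ler_expR -/lk -mulr_natr => le1.
have {}le1 : l ^+ 2 <= 2 * gam * lk * n%:R by lra.
have le2 : e * l ^+ 2 <= dlt * n%:R.
  have -> : dlt * n%:R = e * (2 * gam * lk * n%:R).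
    by rewrite /e; field; rewrite !gt_eqF.
  by rewrite ler_wpM2l // ltW.
apply: (@le_trans _ _ (e * l ^+ 2 + 1 / (4 * e))); last by rewrite lerD2r.
have -> : e * l ^+ 2 + 1 / (4 * e) = l + (2 * e * l - 1) ^+ 2 / (4 * e).
  by field; rewrite gt_eqF.
by rewrite lerDl divr_ge0 ?sqr_ge0 // mulr_ge0 // ltW.
Unshelve. all: end_near. Qed.

Lemma expR_ge_Xfact (y : R) k : 0 <= y -> y ^+ k / k`!%:R <= expR y.
Proof.
move=> y0; case: k => [|k].
  by rewrite expr0 fact0 divr1; apply: le_trans _ (expR_ge1Dx _); rewrite lerDl.
by apply: le_trans _ (expR_ge1Dxn k y0); rewrite lerDr.
Qed.

(** With A = k0 * exp 2 and k = n + 1 - i, the bound nu ^ k / k! <= A ^ (- k) *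
    exp (A * nu) lets A ^ (- k) absorb k0 ^ (n + 1) with a gain exp (- 2 * n),
    while exp (A * nu) costs at most exp n once nu grows with slope 1 / A. *)
Lemma picard_error_cvg0 (nu : nat -> R) (k0 i : nat) :
  (1 <= k0)%N -> (forall n, 0 <= nu n) ->
  (forall dlt : R, 0 < dlt ->
     exists C : R, \forall n \near \oo, nu n <= dlt * n%:R + C) ->
  (k0 ^ n.+1)%:R * (nu n ^+ (n.+1 - i) / (n.+1 - i)`!%:R)
    @[n --> \oo] --> (0 : R).
Proof.
move=> k01 nu0 sub.
have k0gt0 : 0 < k0%:R :> R by rewrite ltr0n.
set A := k0%:R * expR 2 : R.
have A0 : 0 < A by rewrite mulr_gt0 ?expR_gt0.
have [|C nuC] := sub A^-1; first by rewrite invr_gt0.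
pose D := k0%:R ^+ i * expR (2 * i%:R) * expR (A * C).
have cvgD : D * expR (- n%:R) @[n --> \oo] --> (0 : R).
  by rewrite -[X in _ --> X](mulr0 D); apply: cvgM; [exact: cvg_cst|exact: cvgn_expR].
apply: (squeeze_cvgr _ (cvg_cst 0) cvgD); near=> n; apply/andP; split.
  by rewrite mulr_ge0 // divr_ge0 // exprn_ge0.
have ni : (i <= n.+1)%N by apply: leqW; near: n; exact: nbhs_infty_ge.
have nuCn : nu n <= A^-1 * n%:R + C by near: n.
set k := (n.+1 - i)%N.
have nk : (n.+1 = k + i)%N by rewrite subnK.
have -> : nu n ^+ k / k`!%:R = A ^- k * ((A * nu n) ^+ k / k`!%:R).
  have -> : (A * nu n) ^+ k = A ^+ k * nu n ^+ k by exact: exprMn.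
  by rewrite -[in RHS]mulrA mulKf // expf_neq0 // gt_eqF.
apply: (@le_trans _ _ ((k0 ^ n.+1)%:R * (A ^- k * expR (A * nu n)))).
  rewrite ler_wpM2l // ler_wpM2l ?invr_ge0 ?exprn_ge0 //; first exact: ltW.
  by rewrite expR_ge_Xfact // mulr_ge0 // ltW.
have -> : (k0 ^ n.+1)%:R * (A ^- k * expR (A * nu n)) =
    k0%:R ^+ i * expR (2 * i%:R) * (expR (- (2 * n.+1%:R)) * expR (A * nu n)).
  have -> : A ^+ k = k0%:R ^+ k * expR (2 * k%:R) by rewrite expRM_natr exprMn.
  have -> : 2 * n.+1%:R = 2 * k%:R + 2 * i%:R :> R by rewrite nk natrD mulrDr.
  rewrite {1}nk natrX exprD expRN expRD.
  have k00 : k0%:R ^+ k != 0 :> R by rewrite expf_neq0 // gt_eqF.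
  have e0 y : expR y != 0 :> R by rewrite gt_eqF ?expR_gt0.
  by field; rewrite k00 !e0.
rewrite /D -[leRHS]mulrA ler_wpM2l ?mulr_ge0 ?exprn_ge0 ?expR_ge0 //.
rewrite -!expRD ler_expR.
have : A * nu n <= n%:R + A * C.
  have -> : n%:R + A * C = A * (A^-1 * n%:R + C).
    by rewrite mulrDr mulrA mulfV ?mul1r // gt_eqF.
  by rewrite ler_wpM2l // ltW.
rewrite -(natr1 n); have : 0 <= n%:R :> R by [].
by move: (A * nu n) (A * C) => p q; lra.
Unshelve. all: end_near. Qed.

End growth.

Section weighted_majorant.
Context {R : realType}.
Variable rho : nat -> {posnum R}.

Lemma nneseries_from1 (u : nat -> R) :
  (\sum_(1 <= i <oo) (u i)%:E < +oo)%E -> (forall i, 0 <= u i) ->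
  (\sum_(0 <= i <oo) (if (0 < i)%N then u i else 0)%:E < +oo)%E.
Proof.
move=> uoo u0; rewrite (nneseries_split 0 1); last first.
  by move=> k _; rewrite lee_fin; case: ifP.
rewrite add0n big_nat1 add0e; apply: le_lt_trans uoo.
by apply: lee_nneseries => [i i1 _|i _]; rewrite lee_fin; case: ifP.
Qed.

(** Apply [slowly_varying_majorant] to b ^ 2 * rho, divide by rho, whose
    neighbouring values are comparable up to N, and take square roots. *)
Lemma weighted_slowly_varying_majorant (N : R) (b : nat -> R) :
  0 < N ->
  (forall i, (1 <= i)%N -> (rho i)%:num <= N * (rho i.+1)%:num) ->
  (forall i, (1 <= i)%N -> (rho i.+1)%:num <= N * (rho i)%:num) ->
  (\sum_(1 <= i <oo) (b i ^+ 2 * (rho i)%:num)%:E < +oo)%E ->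
  exists B : nat -> R,
    [/\ forall i, (1 <= i)%N -> b i <= B i,
        forall i, (1 <= i)%N -> B i.+1 <= Num.sqrt (2 * N) * B i /\
                                B i <= Num.sqrt (2 * N) * B i.+1 &
        (\sum_(1 <= i <oo) (B i ^+ 2 * (rho i)%:num)%:E < +oo)%E].
Proof.
move=> N0 rN rN' /nneseries_from1 boo.
have [||sg [bsg sg2 sgoo]] := @slowly_varying_majorant R
   (fun i => if (0 < i)%N then b i ^+ 2 * (rho i)%:num else 0).
- by move=> i; case: ifP => // _; rewrite mulr_ge0 ?sqr_ge0.
- by apply: boo => i; rewrite mulr_ge0 ?sqr_ge0.
have sg0 i : 0 <= sg i.
  by apply: le_trans _ (bsg i); case: ifP => // _; rewrite mulr_ge0 ?sqr_ge0.
have sr0 i : 0 <= sg i / (rho i)%:num by rewrite divr_ge0.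
exists (fun i => Num.sqrt (sg i / (rho i)%:num)); split.
- move=> i i1; apply: le_trans (ler_norm _) _; rewrite -sqrtr_sqr.
  by rewrite ler_sqrt // ler_pdivlMr //; have := bsg i; rewrite i1.
- move=> i i1; rewrite -!sqrtrM ?mulr_ge0 ?(ltW N0) //.
  have [h1 h2] := sg2 i.
  rewrite !ler_sqrt ?mulr_ge0 ?divr_ge0 ?(ltW N0) //; split.
    rewrite ler_pdivrMr //.
    have -> : 2 * N * (sg i / (rho i)%:num) * (rho i.+1)%:num =
       2 * sg i * (N * (rho i.+1)%:num / (rho i)%:num) by ring.
    by rewrite (le_trans h1) // ler_peMr ?mulr_ge0 // ler_pdivlMr // mul1r rN.
  rewrite ler_pdivrMr //.
  have -> : 2 * N * (sg i.+1 / (rho i.+1)%:num) * (rho i)%:num =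
       2 * sg i.+1 * (N * (rho i)%:num / (rho i.+1)%:num) by ring.
  by rewrite (le_trans h2) // ler_peMr ?mulr_ge0 // ler_pdivlMr // mul1r rN'.
- apply: le_lt_trans sgoo; rewrite [leRHS](nneseries_split 0 1); last first.
    by move=> k _; rewrite lee_fin.
  apply: le_trans (leeDr _ _); last by rewrite sume_ge0 // => i _; rewrite lee_fin.
  apply: lee_nneseries => [i *|i _]; rewrite lee_fin.
    by rewrite mulr_ge0 ?sqr_ge0.
  by rewrite sqr_sqrtr // divfK.
Qed.

(** For theta >= 1 the space with exponent 2 * theta is contained in the one with
    exponent 2, because the weight has finite total mass. *)
Lemma affine_ell_summable (theta : R) (x : nat -> R) (c : R) : 1 <= theta ->
  (\sum_(1 <= i <oo) ((rho i)%:num)%:E < +oo)%E ->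
  x \in ell (2 * theta) rho ->
  (\sum_(1 <= i <oo) ((2 * `|x i| + c) ^+ 2 * (rho i)%:num)%:E < +oo)%E.
Proof.
move=> theta1 roo /andP[_ xoo].
have E i : ((2 * `|x i| + c) ^+ 2 * (rho i)%:num <=
   8 * (`|x i| `^ (2 * theta) * (rho i)%:num) + (8 + 2 * c ^+ 2) * (rho i)%:num).
  rewrite mulrA -mulrDl ler_wpM2r //.
  have : `|x i| ^+ 2 <= 1 + `|x i| `^ (2 * theta).
    have [x1|x1] := leP `|x i| 1.
      by rewrite (@le_trans _ _ 1) ?exprn_ile1 // lerDl powR_ge0.
    rewrite -powR_mulrn // (@le_trans _ _ (`|x i| `^ (2 * theta))) ?lerDr //.
    by rewrite ler_powR ?ler_peMr // ltW.
  have := sqr_ge0 (2 * `|x i| - c); nra.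
apply: (@le_lt_trans _ _ (8%:E * ell_sum (2 * theta) rho x +
    (8 + 2 * c ^+ 2)%:E * \sum_(1 <= i <oo) ((rho i)%:num)%:E)%E).
  rewrite /ell_sum -!nneseriesZl; last 2 first.
    by move=> i _; rewrite lee_fin ?mulr_ge0 ?powR_ge0.
    by move=> i _; rewrite lee_fin ?mulr_ge0 ?powR_ge0.
  rewrite -nneseriesD; last 2 first.
    by move=> i *; rewrite -EFinM lee_fin !mulr_ge0 // powR_ge0.
    move=> i *; rewrite -EFinM lee_fin; apply: mulr_ge0 => //.
    by rewrite addr_ge0 // mulr_ge0 // sqr_ge0.
  apply: lee_nneseries => [i *|i _]; first by rewrite lee_fin mulr_ge0 ?sqr_ge0.
  by rewrite -!EFinM -EFinD lee_fin.
apply: lte_add_pinfty; apply: lte_mul_pinfty => //.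
by rewrite lee_fin addr_ge0 // mulr_ge0 ?sqr_ge0.
Qed.

End weighted_majorant.

(** * Pathwise convergence of the finite-volume systems *)

Section pathwise_convergence.
Context {R : realType}.
Variables (rho : nat -> {posnum R}) (a : nat -> nat -> R) (f : R -> R).
Variables (theta M N eta : R) (x : nat -> R).
Hypothesis theta1 : 1 <= theta.
Hypothesis M0 : 0 < M.
Hypothesis N0 : 0 < N.
Hypothesis eta0 : 0 <= eta.
Hypothesis rho_sum : (\sum_(1 <= i <oo) ((rho i)%:num)%:E < +oo)%E.
Hypothesis rho_ratio : forall i, (1 <= i)%N ->
  (rho i)%:num <= N * (rho i.+1)%:num /\ (rho i.+1)%:num <= N * (rho i)%:num.
Hypothesis aM : forall i, (1 <= i)%N -> `|a i i.-1| <= M /\ `|a i i.+1| <= M.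
Hypothesis cf : continuous f.
Hypothesis f_le : forall z, 1 < z -> f z <= eta.
Hypothesis f_ge : forall z, z < -1 -> - eta <= f z.
(* L controls the locally Lipschitz part of f and K the two others: the globally
   Lipschitz one and the one that is decreasing up to a linear term. *)
Variables (L : nat -> R) (K : R).
Hypothesis L0 : forall n, 0 < L n.
Hypothesis K0 : 0 <= K.
Hypothesis fL : forall (n : nat) (y z : R),
  `|y| <= n%:R -> `|z| <= n%:R -> z <= y -> f y - f z <= (L n + K) * (y - z).
Hypothesis L_sublinear : forall k0 : nat, (2 <= k0)%N ->
  forall dlt : R, 0 < dlt ->
  exists C : R, \forall n \near \oo, L (k0 ^ n)%N <= dlt * n%:R + C.
Hypothesis x_ell : x \in ell (2 * theta) rho.

(** The sequence beta bounds all solutions in all volumes at once; the error eps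
    at site i does not depend on the two solutions that are compared. *)
Theorem path_solutions_cauchy (w : R -> R) (T : R) : continuous w -> 0 <= T ->
  exists beta : nat -> R,
    [/\ forall i, (1 <= i)%N -> 0 <= beta i,
        (\sum_(1 <= i <oo) (beta i ^+ 2 * (rho i)%:num)%:E < +oo)%E,
        forall n Y, path_solution a f w x n Y -> forall i t,
          (1 <= i <= n)%N -> 0 <= t <= T -> `|Y i t| <= beta i &
        forall i, exists2 eps : nat -> R, eps n @[n --> \oo] --> (0 : R) &
          forall n m Y Z, (n <= m)%N ->
            path_solution a f w x n Y -> path_solution a f w x m Z ->
            (i <= n)%N -> forall t, 0 <= t <= T ->
            `|Y i t - Z i t| <= eps n].
Proof.
move=> cw T0.
have [c _ cmax] := @EVT_max R (fun s => `|w s|) 0 T T0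
  (continuous_subspaceT (fun s => continuous_comp (cw s) (@norm_continuous _ _ _))).
set wbar := `|w c| in cmax.
have w_le t : 0 <= t <= T -> `|w t| <= wbar.
  by move=> tT; apply: cmax; rewrite in_itv.
pose b i := 2 * `|x i| + (1 + 2 * wbar + eta * T).
have bsum := affine_ell_summable (1 + 2 * wbar + eta * T) theta1 rho_sum x_ell.
have [B [bB Bk Bsum]] := weighted_slowly_varying_majorant N0
  (fun i i1 => (rho_ratio i1).1) (fun i i1 => (rho_ratio i1).2) bsum.
set kappa := Num.sqrt (2 * N) in Bk.
have kappa0 : 0 < kappa by rewrite sqrtr_gt0 mulr_gt0.
pose E := expR (4 * M * kappa * T).
have E1 : 1 <= E by rewrite /E -expR0 ler_expR !mulr_ge0 // ltW.
have E0 : 0 <= E by exact: le_trans E1.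
pose beta i := 2 * (B i * E).
have B0 i : (1 <= i)%N -> 0 <= B i.
  move=> i1; apply: le_trans (bB i i1).
  have := normr_ge0 (x i); have := normr_ge0 (w c).
  have := mulr_ge0 eta0 T0; rewrite -/wbar; lra.
have beta0 i : (1 <= i)%N -> 0 <= beta i.
  by move=> i1; rewrite /beta !mulr_ge0 ?B0.
have bound n Y : path_solution a f w x n Y -> forall i t,
    (1 <= i <= n)%N -> 0 <= t <= T -> `|Y i t| <= beta i.
  move=> sY i t iln t0T; have /andP[t0 tT] := t0T; have /andP[i1 _] := iln.
  apply: le_trans (barrier_bound cf M0 aM eta0 f_le f_ge w_le kappa0 Bk _ sY iln t0T) _.
    move=> j j1; apply: le_trans (bB j j1); lra.
  rewrite /beta ler_wpM2l // ler_wpM2l ?B0 // ler_expR ler_wpM2l //.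
  by rewrite !mulr_ge0 // ltW.
exists beta; split => //.
  have -> : (\sum_(1 <= i <oo) (beta i ^+ 2 * (rho i)%:num)%:E =
      \sum_(1 <= i <oo) ((4 * E ^+ 2)%:E * (B i ^+ 2 * (rho i)%:num)%:E))%E.
    by apply: eq_eseriesr => i _; rewrite -EFinM /beta; congr EFin; ring.
  rewrite nneseriesZl; last by move=> i _; rewrite lee_fin mulr_ge0 ?sqr_ge0.
  by apply: lte_mul_pinfty => //; rewrite lee_fin mulr_ge0 ?sqr_ge0.
have beta_k i : (1 <= i)%N -> beta i.+1 <= kappa * beta i.
  move=> /Bk[h _]; rewrite /beta.
  have -> : kappa * (2 * (B i * E)) = 2 * (kappa * B i * E) by ring.
  by rewrite ler_wpM2l // ler_wpM2r.
(* beta grows at most geometrically, with a ratio below the integer k0. *)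
pose k0 := (Num.truncn (kappa + 2 * beta 1%N)).+2.
have k0ge : kappa + 2 * beta 1%N <= k0%:R.
  by apply: ltW; apply: lt_trans (truncnS_gt _) _; rewrite ltr_nat.
have beta1 := beta0 1%N isT.
have beta_pow i : (1 <= i)%N -> 2 * beta i <= (k0 ^ i)%:R.
  case: i => // i _; elim: i => [|i IH].
    by rewrite expn1; apply: le_trans k0ge; rewrite lerDr ltW.
  rewrite expnS natrM; apply: le_trans (_ : kappa * (2 * beta i.+1) <= _).
    by rewrite [leRHS]mulrCA ler_wpM2l // beta_k.
  apply: ler_pM => //; [exact: ltW|by rewrite mulr_ge0 ?beta0|].
  by apply: le_trans k0ge; rewrite lerDl mulr_ge0.
have pow_mono i n : (i <= n)%N -> (k0 ^ i)%:R <= (k0 ^ n)%:R :> R.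
  by move=> le_in; rewrite ler_nat leq_exp2l.
pose Lam n := L (k0 ^ n)%N + K.
have Lam0 n : 0 <= Lam n by rewrite addr_ge0 // ltW.
pose nu n := (Lam n + 2 * M) * T.
have nu0 n : 0 <= nu n by rewrite mulr_ge0 // addr_ge0 // mulr_ge0 // ltW.
move=> i; exists (fun n => (k0 ^ n.+1)%:R * (nu n ^+ (n.+1 - i) / (n.+1 - i)`!%:R)).
  apply: picard_error_cvg0 => // dlt dlt0.
  have [||C LC] := @L_sublinear k0 _ (dlt / (T + 1)); first by [].
    by rewrite divr_gt0 // ltr_wpDl.
  exists ((C + K + 2 * M) * T) => /=; near=> n.
  have LCn : L (k0 ^ n)%N <= dlt / (T + 1) * n%:R + C by near: n.
  have : dlt / (T + 1) * T <= dlt.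
    by rewrite mulrAC ler_pdivrMr ?ltr_wpDl // ler_wpM2l ?ltW // ltrDl.
  have n0 : 0 <= n%:R :> R by [].
  move=> /(ler_wpM2r n0) dT; rewrite /nu /Lam.
  have := ler_wpM2r T0 LCn; lra.
move=> n m Y Z nm sY sZ le_in t t0T; have /andP[t0 tT] := t0T.
apply: le_trans (@difference_bound _ a f w x cf M M0 aM T n m Y Z beta (Lam n)
   (k0 ^ n.+1)%:R nm sY sZ (Lam0 n) beta0 (bound _ _ sY) (bound _ _ sZ) _ _
   (n.+1 - i) i t _ t0T) _.
- by move=> j /andP[j1 jn]; apply: le_trans (beta_pow j j1) _; exact: pow_mono.
- move=> j y z /andP[j1 jn] yb zb zy; apply: fL => //.
    apply: le_trans yb _; apply: le_trans (pow_mono _ _ jn).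
    by apply: le_trans (beta_pow _ j1); have := beta0 j j1; lra.
  apply: le_trans zb _; apply: le_trans (pow_mono _ _ jn).
  by apply: le_trans (beta_pow _ j1); have := beta0 j j1; lra.
- by rewrite subnKC // leqW.
rewrite ler_wpM2l // ler_wpM2r ?invr_ge0 //.
have nut0 : 0 <= Lam n + 2 * M by rewrite addr_ge0 // mulr_ge0 // ltW.
by apply: lerXn2r; rewrite ?nnegrE ?mulr_ge0 // ler_wpM2l.
Unshelve. all: end_near. Qed.

End pathwise_convergence.

(** * Convergence in the path space *)

Section path_space_topology.
Context {R : realType} (rho : nat -> {posnum R}).
Local Notation Om := (Omega_Spin rho).

(** A base of neighbourhoods of g indexed by a single integer, which controls both
    the length of the time interval and the accuracy. *)
Definition path_ball (k : nat) (g : Om) : set Om :=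
  [set h | forall t : Rplus R, \val t <= k%:R -> `|g t - h t| < k.+1%:R^-1].

Let max0_ge0 (t : R) : t \in [set t : R | 0 <= t] -> Num.max 0 t = t.
Proof. by rewrite inE => /max_idPr. Qed.

Lemma pos_part_in (t : R) : Num.max 0 t \in [set t : R | 0 <= t].
Proof. by rewrite inE /= le_max lexx. Qed.

Definition pos_part (t : R) : Rplus R := SigSub (pos_part_in t).

Lemma pos_part_continuous : continuous pos_part.
Proof.
apply: continuous_comp_initial => t /=.
have -> : \val \o pos_part = (cst 0 : R -> R) \max id by [].
by apply: continuous_max; [exact: cvg_cst|exact: cvg_id].
Qed.

(** An initial segment of the half-line is the image of a compact interval of the
    line under the positive part. *)
Lemma compact_initial_segment (k : R) : compact [set t : Rplus R | \val t <= k].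
Proof.
have -> : [set t : Rplus R | \val t <= k] = pos_part @` `[0, k].
  apply/seteqP; split => [t /= tk|_ /= [t + <-]].
    exists (\val t); last by apply: val_inj; rewrite /= max0_ge0 //; exact: valP.
    by rewrite in_itv/= tk andbT; have := valP t; rewrite inE.
  by rewrite in_itv/= => /andP[t0 tk]; rewrite (max_idPr t0).
apply: continuous_compact; last exact: segment_compact.
exact: continuous_subspaceT pos_part_continuous.
Qed.

Lemma compact_Rplus_bounded (A : set (Rplus R)) : compact A ->
  exists k : nat, forall t, A t -> \val t <= k%:R.
Proof.
move=> cA.
have cv : continuous (\val : Rplus R -> R) by exact: initial_continuous.
have /compact_bounded[M [_ Mb]] := continuous_compact (continuous_subspaceT cv) cA.
exists (Num.truncn (M + 1)).+1 => t At.
apply: le_trans (ler_norm _) _.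
apply: le_trans (Mb (M + 1) _ _ _) _; [by rewrite ltrDl|by exists t|].
by apply: ltW; exact: truncnS_gt.
Qed.

Lemma nbhs_path_ball (g : Om) (A : set Om) :
  nbhs g A <-> exists k, path_ball k g `<=` A.
Proof.
split.
  case=> [_ [[B oB <-] Bg subA]].
  pose C (k : nat) : set (Rplus R -> ell2 rho) :=
    [set h | forall t : Rplus R, \val t <= k%:R -> `|g t - h t| < k.+1%:R^-1].
  have C_mono k k' : (k <= k')%N -> C k' `<=` C k.
    move=> kk h Ch t tk; apply: lt_le_trans (Ch t _) _.
      by apply: le_trans tk _; rewrite ler_nat.
    by rewrite lef_pV2 ?posrE // ler_nat ltnS.
  pose F : set_system (Rplus R -> ell2 rho) := filter_from setT C.
  have FF : Filter F.
    apply: filter_from_filter; first by exists 0%N.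
    move=> i j _ _; exists (maxn i j) => //.
    by move=> h Ch; split; apply: C_mono Ch; rewrite ?leq_maxl ?leq_maxr.
  have Fg : {family compact, F --> (g : Rplus R -> ell2 rho)}.
    apply/fam_cvgP => K cK; move=> P /uniform_nbhs[E [entE EP]].
    have [k Kk] := compact_Rplus_bounded cK.
    move: entE; rewrite -entourage_ballE => -[e /= e0 eE].
    exists (maxn k (Num.truncn e^-1)) => //= h Ch; apply: EP => t Kt.
    apply: eE; rewrite /= -ball_normE /ball_ /=.
    apply: lt_le_trans (Ch t _) _.
      by apply: le_trans (Kk _ Kt) _; rewrite ler_nat leq_maxl.
    rewrite invf_ple ?posrE //; apply: ltW; apply: lt_le_trans (truncnS_gt _) _.
    by rewrite ler_nat ltnS leq_maxr.
  have [k _ Ck] : F B.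
    apply: Fg; apply: open_nbhs_nbhs; split => //.
  by exists k => h hk; apply: subA; exact: Ck.
move=> [k kA].
pose B : set {family compact, Rplus R -> ell2 rho} :=
  [set h | forall t : Rplus R, \val t <= k%:R ->
     [set xy : ell2 rho * ell2 rho | ball xy.1 k.+1%:R^-1 xy.2] (g t, h t)].
have gB : nbhs (g : {family compact, Rplus R -> ell2 rho}) B.
  apply: (@fam_nbhs _ _ compact [set t : Rplus R | \val t <= k%:R]
     [set xy : ell2 rho * ell2 rho | ball xy.1 k.+1%:R^-1 xy.2]).
    by rewrite -entourage_ballE; exists k.+1%:R^-1 => //=; rewrite invr_gt0.
  exact: compact_initial_segment.
move: gB; rewrite nbhsE => -[B' [oB' B'g] B'B].
exists ((id : Om -> {family compact, Rplus R -> ell2 rho}) @^-1` B').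
split; [by exists B'|exact: B'g|].
move=> h B'h; apply: kA => t tk; have := B'B _ B'h t tk.
by rewrite /= -ball_normE.
Qed.

End path_space_topology.

Section ell2_convergence.
Context {R : realType} (rho : nat -> {posnum R}).

Lemma ell2_norm_le (z : ell2 rho) (e : R) : 0 <= e ->
  (\sum_(1 <= i <oo) (z i ^+ 2 * (rho i)%:num)%:E <= (e ^+ 2)%:E)%E ->
  `|z| <= e.
Proof.
move=> e0; have -> : (\sum_(1 <= i <oo) (z i ^+ 2 * (rho i)%:num)%:E)%E =
    ell_sum 2 rho z.
  apply: eq_eseriesr => i _; rewrite powR_mulrn ?normr_ge0 //.
  by rewrite real_normK ?num_real.
move=> ze; have z0 := ell_sum_ge0 2 rho z.
have -> : `|z| = ell_norm 2 rho z by [].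
rewrite /ell_norm; have zfin : ell_sum 2 rho z \is a fin_num.
  by rewrite ge0_fin_numE // (le_lt_trans ze) // ltry.
have {}ze : fine (ell_sum 2 rho z) <= e ^+ 2 by rewrite -lee_fin fineK.
rewrite powR12_sqrt ?fine_ge0 //.
by rewrite -(ger0_norm e0) -sqrtr_sqr ler_sqrt ?sqr_ge0.
Qed.

(** Dominated convergence for series, uniformly in the parameter t: the tail of
    the norm is controlled by beta, and finitely many sites remain. *)
Lemma ell2_dominated_cvg (I : Type) (A : set I) (u : nat -> I -> ell2 rho)
    (g : I -> ell2 rho) (beta : nat -> R) (n0 : nat) :
  (\sum_(1 <= i <oo) (beta i ^+ 2 * (rho i)%:num)%:E < +oo)%E ->
  (forall n t i, (n0 <= n)%N -> A t -> (1 <= i)%N -> `|u n t i| <= beta i) ->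
  (forall t i, A t -> (1 <= i)%N -> `|g t i| <= beta i) ->
  (forall i, (1 <= i)%N -> exists2 eps : nat -> R, eps n @[n --> \oo] --> (0 : R) &
     forall n t, (n0 <= n)%N -> (i <= n)%N -> A t -> `|u n t i - g t i| <= eps n) ->
  forall e, 0 < e -> \forall n \near \oo, forall t, A t -> `|u n t - g t| <= e.
Proof.
move=> bsum ub gb uge e e0.
have b0 i : (0 <= (beta i ^+ 2 * (rho i)%:num)%:E)%E.
  by rewrite lee_fin mulr_ge0 ?sqr_ge0.
have [k [k1 ktail]] : exists k, (1 <= k)%N /\
    (4%:E * \sum_(k <= i <oo) (beta i ^+ 2 * (rho i)%:num)%:E <= (e ^+ 2 / 2)%:E)%E.
  pose v i : R := if (0 < i)%N then beta i ^+ 2 * (rho i)%:num else 0.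
  have v0 i : (0 <= (v i)%:E)%E by rewrite /v; case: ifP => _; [exact: b0|].
  have voo : (\sum_(0 <= i <oo) (v i)%:E < +oo)%E.
    rewrite (nneseries_split 0 1) // add0n big_nat1 add0e.
    apply: le_lt_trans bsum; apply: lee_nneseries => // i _.
    by rewrite /v; case: ifP => // _; exact: b0.
  have := nneseries_tail_cvg voo (fun i _ => v0 i).
  have e8 : 0 < e ^+ 2 / 8 by rewrite divr_gt0 // exprn_gt0.
  move=> /fine_cvgP[_ /cvgrPdist_le /(_ _ e8)] ev.
  have := nneseries_tail_cvg voo (fun i _ => v0 i).
  move=> /fine_cvgP[evf _].
  near \oo => k; exists k; split; first by near: k; exact: nbhs_infty_ge.
  have k1 : (1 <= k)%N by near: k; exact: nbhs_infty_ge.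
  have -> : (\sum_(k <= i <oo) (beta i ^+ 2 * (rho i)%:num)%:E =
             \sum_(k <= i <oo) (v i)%:E)%E.
    rewrite eseries_cond [RHS]eseries_cond; apply: eq_eseriesr => i /=.
    by rewrite /v; move=> ki; rewrite (leq_trans k1 ki).
  have fk : (\sum_(k <= i <oo) (v i)%:E \is a fin_num)%E by near: k.
  have dk : `|0 - fine (\sum_(k <= i <oo) (v i)%:E)%E| <= e ^+ 2 / 8 by near: k.
  rewrite -(fineK fk) -EFinM lee_fin.
  by move: dk; rewrite sub0r normrN => /(le_trans (ler_norm _)); lra.
have [eps epsP] : exists eps : nat -> nat -> R, forall i,
    eps i n @[n --> \oo] --> (0 : R) /\ ((1 <= i)%N -> forall n t,
      (n0 <= n)%N -> (i <= n)%N -> A t -> `|u n t i - g t i| <= eps i n).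
  suff /choice[eps epsP] : forall i, exists eps : nat -> R,
    eps n @[n --> \oo] --> (0 : R) /\ ((1 <= i)%N -> forall n t,
      (n0 <= n)%N -> (i <= n)%N -> A t -> `|u n t i - g t i| <= eps n).
    by exists eps.
  move=> [|i]; first by exists (fun=> 0); split => //; exact: cvg_cst.
  by have [ep ? ?] := uge i.+1 isT; exists ep.
have cS : \sum_(1 <= i < k) (eps i n ^+ 2 * (rho i)%:num) @[n --> \oo] --> (0 : R).
  elim: (index_iota 1 k) => [|i s IH].
    by under eq_cvg do rewrite big_nil; exact: cvg_cst.
  under eq_cvg do rewrite big_cons.
  have [ep0 _] := epsP i.
  have ep2 : eps i n ^+ 2 * (rho i)%:num @[n --> \oo] --> (0 : R).
    rewrite -[X in _ --> X](mul0r (rho i)%:num); apply: cvgM; last exact: cvg_cst.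
    by rewrite -[X in _ --> X](mul0r 0); under eq_fun do rewrite expr2; exact: cvgM.
  have : (0 : R) + 0 = 0 by exact: addr0.
  by move=> {2}<-; exact: (cvgD ep2 IH).
have e2 : 0 < e ^+ 2 / 2 by rewrite divr_gt0 // exprn_gt0.
move/cvgrPdist_le : cS => /(_ _ e2) ev.
near=> n => t At.
have n0n : (n0 <= n)%N by near: n; exact: nbhs_infty_ge.
have kn : (k <= n)%N by near: n; exact: nbhs_infty_ge.
have Sn : `|0 - \sum_(1 <= i < k) (eps i n ^+ 2 * (rho i)%:num)| <= e ^+ 2 / 2.
  by near: n.
have ugE i : (u n t - g t) i = u n t i - g t i.
  have -> : ell2_seq (u n t - g t) = ell2_seq (u n t) - ell2_seq (g t).
    exact: (raddfB (val : ell2 rho -> nat -> R)).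
  by [].
apply: ell2_norm_le; first exact: ltW.
rewrite (nneseries_split 1 (k - 1)); last first.
  by move=> i _; rewrite lee_fin mulr_ge0 ?sqr_ge0.
rewrite subnKC //; have -> : e ^+ 2 = e ^+ 2 / 2 + e ^+ 2 / 2 by lra.
rewrite EFinD; apply: leeD.
  apply: (@le_trans _ _ (\sum_(1 <= i < k) (eps i n ^+ 2 * (rho i)%:num))%:E).
    rewrite sumEFin lee_fin; apply: ler_sum_nat => i /andP[i1 ik].
    rewrite ler_wpM2r // ugE -real_normK ?num_real //.
    apply: lerXn2r; rewrite ?nnegrE //; last first.
      by apply: ((epsP i).2 i1) => //; apply: ltnW; exact: leq_trans ik kn.
    apply: le_trans ((epsP i).2 i1 n t n0n _ At); first exact: normr_ge0.
    by apply: ltnW; exact: leq_trans ik kn.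
  rewrite lee_fin; apply: le_trans Sn; rewrite sub0r normrN; exact: ler_norm.
apply: le_trans ktail; rewrite -nneseriesZl; last by move=> *; exact: b0.
rewrite eseries_cond [leRHS]eseries_cond.
apply: lee_nneseries => [i *|i /=]; first by rewrite lee_fin mulr_ge0 ?sqr_ge0.
move=> ki; have i1 := leq_trans k1 ki.
rewrite -EFinM lee_fin mulrA ler_wpM2r //.
have -> : (u n t - g t) i ^+ 2 = `|u n t i - g t i| ^+ 2.
  by rewrite real_normK ?num_real // -ugE.
have -> : 4 * beta i ^+ 2 = (beta i + beta i) ^+ 2 by ring.
have bi0 : 0 <= beta i by apply: le_trans (gb t i At i1); exact: normr_ge0.
apply: lerXn2r; rewrite ?nnegrE ?addr_ge0 //.
by apply: le_trans (ler_normB _ _) _; apply: lerD; [exact: ub|exact: gb].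
Unshelve. all: end_near. Qed.

End ell2_convergence.

Section path_space_limit.
Context {R : realType} (rho : nat -> {posnum R}).
Local Notation Om := (Omega_Spin rho).

Let norm_three_eps (V : normedModType R) (p q r s : V) (e : R) :
  `|q - p| <= e / 3 -> `|q - r| <= e / 3 -> `|r - s| <= e / 3 -> `|p - s| <= e.
Proof.
move=> qp qr rs; have -> : p - s = - (q - p) + (q - r) + (r - s).
  by rewrite opprB !addrA subrK subrK.
have := ler_normD (- (q - p) + (q - r)) (r - s).
have := ler_normD (- (q - p)) (q - r); rewrite normrN; lra.
Qed.

(** The limit is built site by site from the completeness of R; the majorant puts
    it in the weighted space and makes the convergence locally uniform in time,
    so that the limit is continuous. *)
Lemma Omega_Spin_dominated_cvg (u : nat -> Om) :
  (forall T : R, 0 <= T -> exists beta : nat -> R,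
    [/\ (\sum_(1 <= i <oo) (beta i ^+ 2 * (rho i)%:num)%:E < +oo)%E,
        forall n (t : Rplus R) i, (1 <= n)%N -> \val t <= T -> (1 <= i)%N ->
          `|u n t i| <= beta i &
        forall i, (1 <= i)%N ->
          exists2 eps : nat -> R, eps n @[n --> \oo] --> (0 : R) &
            forall n m (t : Rplus R), (1 <= n)%N -> (i <= n)%N -> (n <= m)%N ->
              \val t <= T -> `|u n t i - u m t i| <= eps n]) ->
  exists g : Om, u n @[n --> \oo] --> g.
Proof.
move=> H.
pose gg (t : Rplus R) (i : nat) : R :=
  if i == 0%N then 0 else limn (fun n => u n t i).
have vge0 (t : Rplus R) : 0 <= \val t by have := valP t; rewrite inE.
have gcvg (t : Rplus R) i : (1 <= i)%N -> (fun n => u n t i) @ \oo --> gg t i.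
  move=> i1; rewrite /gg gtn_eqF //; apply/cauchy_cvgP/cauchyP => e e0.
  have [beta [_ _ /(_ i i1)[eps eps0 epsP]]] := H _ (vge0 t).
  have e2 : 0 < e / 2 by rewrite divr_gt0.
  move/cvgrPdist_lt : eps0 => /(_ _ e2) ev.
  near \oo => p.
  have pi : (i <= p)%N by near: p; exact: nbhs_infty_ge.
  have p1 : (1 <= p)%N by apply: leq_trans i1 pi.
  have ep : `|0 - eps p| < e / 2 by near: p.
  have {}ep : eps p < e / 2.
    by move: ep; rewrite sub0r normrN; apply: le_lt_trans; exact: ler_norm.
  exists (u p t i).
  suff : \forall n \near \oo, ball (u p t i) e (u n t i) by [].
  near=> n; rewrite -ball_normE /ball_ /=.
  have pn : (p <= n)%N by near: n; exact: nbhs_infty_ge.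
  apply: le_lt_trans (epsP _ _ _ p1 pi pn (lexx _)) _.
  by apply: lt_le_trans ep _; rewrite ler_pdivrMr // ler_peMr ?ler1n // ltW.
have gb T (beta : nat -> R) : 0 <= T ->
    (forall n (t : Rplus R) i, (1 <= n)%N -> \val t <= T -> (1 <= i)%N ->
          `|u n t i| <= beta i) ->
    forall (t : Rplus R) i, \val t <= T -> (1 <= i)%N -> `|gg t i| <= beta i.
  move=> T0 ub t i tT i1.
  have /cvg_norm cn := gcvg t i i1.
  apply: (@cvgr_to_le _ _ _ _ _ _ _ cn); near=> n; apply: ub => //.
  by near: n; exact: nbhs_infty_ge.
have gl (t : Rplus R) : gg t \in ell 2 rho.
  have [beta [bsum ub _]] := H _ (vge0 t).
  rewrite inE /= eqxx /=; apply: le_lt_trans bsum.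
  rewrite /ell_sum; rewrite eseries_cond [leRHS]eseries_cond.
  apply: lee_nneseries => [i *|i /=].
    by rewrite lee_fin mulr_ge0 ?powR_ge0.
  move=> i1; rewrite lee_fin ler_wpM2r // powR_mulrn ?normr_ge0 //.
  have gbi : `|gg t i| <= beta i by exact: (gb _ _ (vge0 t) ub).
  by apply: lerXn2r; rewrite ?nnegrE // (le_trans _ gbi).
pose g0 (t : Rplus R) : ell2 rho := Ell2 (gl t).
have unif T : 0 <= T -> forall e, 0 < e ->
    \forall n \near \oo, forall t : Rplus R, \val t <= T -> `|u n t - g0 t| <= e.
  move=> T0; have [beta [bsum ub uc]] := H _ T0.
  apply: (@ell2_dominated_cvg _ _ _ [set t : Rplus R | \val t <= T]
     (fun n t => u n t) g0 beta 1%N) => //.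
  - by move=> t i tT i1; exact: (gb _ _ T0 ub).
  - move=> i i1; have [eps eps0 epsP] := uc _ i1.
    exists eps => // n t n1 ni tT.
    have cd : `|u n t i - u m t i| @[m --> \oo] --> `|u n t i - g0 t i|.
      apply: cvg_norm; apply: cvgB; first exact: cvg_cst.
      exact: (gcvg t i i1).
    apply: (@cvgr_to_le _ _ _ _ _ _ _ cd); near=> m; apply: epsP => //.
    by near: m; exact: nbhs_infty_ge.
have cg : continuous g0.
  move=> t; apply/(@cvgrPdist_le _ _ _ (nbhs t) (nbhs_filter t)) => e e0.
  have T0 : 0 <= \val t + 1 by rewrite addr_ge0.
  have e3 : 0 < e / 3 by rewrite divr_gt0.
  have [n _ /(_ n (leqnn n)) un] := unif _ T0 _ e3.
  have cu : continuous (u n : Rplus R -> ell2 rho) by exact: cts_fun.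
  have cv : continuous (\val : Rplus R -> R) by exact: initial_continuous.
  have lt1 : nbhs (\val t) [set y : R | y < \val t + 1].
    by apply: lt_nbhsl; rewrite ltrDl.
  have tlt : nbhs t [set s : Rplus R | \val s < \val t + 1] := cv t _ lt1.
  have /cvgrPdist_le /(_ _ e3) ut := cu t.
  near=> s.
  have st : \val s <= \val t + 1 by apply: ltW; near: s.
  have A := un _ st.
  have B : `|u n t - g0 t| <= e / 3 by apply: un; rewrite lerDl.
  have C : `|u n t - u n s| <= e / 3 by near: s.
  exact: (norm_three_eps B C A).
exists (mkcts cg : continuousType _ _).
move=> A /nbhs_path_ball[k kA].
have e0 : 0 < (k.+2%:R : R)^-1 by rewrite invr_gt0.
have := unif k%:R (ler0n _ _) _ e0; apply: filterS => n un.
apply: kA => t tk; rewrite distrC; apply: le_lt_trans (un t tk) _.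
by rewrite ltf_pV2 ?posrE // ltr_nat.
Unshelve. all: end_near. Qed.

End path_space_limit.

(** * Almost sure limits and weak convergence *)

Section almost_sure_limits.
Context {R : realType} {T : ptopologicalType}.
(* T is a space whose topology comes from the countably many relations B k. *)
Variable B : nat -> T -> set T.
Hypothesis nbhsB : forall g A, nbhs g A <-> exists k, B k g `<=` A.
Hypothesis B_sym : forall k g h, B k g h -> B k h g.
Hypothesis B_split : forall k, exists k', forall g h l,
  B k' g h -> B k' h l -> B k g l.

Lemma open_borel (U : set T) : open U -> measurable (U : set (borel T)).
Proof. by move=> oU; exact: sub_sigma_algebra. Qed.

Lemma continuous_borel_measurable (F : T -> R) : continuous F ->
  measurable_fun [set: borel T] (F : borel T -> R).
Proof.
move=> /continuousP cF; apply: (measurability _ (RGenOpens.measurableE R)).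
move=> _ [_ [a [b ->] <-]]; rewrite setTI; apply: open_borel.
by apply: cF; exact: interval_open.
Qed.

(** Let V k be the interior of the set of points whose B k-neighbourhood lies in
    U.  The limit lies in the open set U if and only if, for some k, the
    sequence is eventually in V k: if it lies in U, then some V k is a
    neighbourhood of it, and conversely the limit is eventually B k-close to
    the sequence. *)
Lemma limit_measurable d (Om : measurableType d) (Y : nat -> Om -> borel T)
    (Z : Om -> borel T) :
  (forall n, measurable_fun setT (Y n)) ->
  (forall w, (fun n => Y n w : T) @ \oo --> (Z w : T)) ->
  measurable_fun setT Z.
Proof.
move=> mY YZ.
have borelE : (measurable : set (set (borel T))) = <<s @open T >> by [].
apply: (measurability _ borelE) => _ [U oU <-]; rewrite setTI.
pose V k : set T := [set g | B k g `<=` U]^°.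
have -> : Z @^-1` U = \bigcup_k \bigcup_N \bigcap_(n in [set n | (N <= n)%N])
    (Y n @^-1` V k).
  apply/seteqP; split => w.
    move=> /= UZ.
    have /nbhsB[k0 k0U] : nbhs (Z w : T) U by exact: open_nbhs_nbhs.
    have [k kP] := B_split k0.
    have VZ : V k (Z w).
      by apply/nbhsB; exists k => g Bg h Bh; apply: k0U; exact: kP Bg Bh.
    have nV : nbhs (Z w : T) (V k).
      by apply: open_nbhs_nbhs; split => //; exact: open_interior.
    have [N _ NP] := YZ w _ nV.
    by exists k => //; exists N => // n Nn; exact: NP.
  move=> [k _ [N _ NP]] /=.
  have nB : nbhs (Z w : T) (B k (Z w)) by apply/nbhsB; exists k.
  have [N' _ N'P] := YZ w _ nB.
  have VY : V k (Y (maxn N N') w) by apply: NP => /=; exact: leq_maxl.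
  apply: (interior_subset VY); apply: B_sym; apply: N'P => /=; exact: leq_maxr.
apply: bigcup_measurable => k _; apply: bigcup_measurable => N _.
apply: bigcap_measurable => [|n _]; first by exists N => /=.
rewrite -[X in measurable X]setTI; apply: mY => //.
by apply: open_borel; exact: open_interior.
Qed.

Context d (Om : measurableType d) (P : probability Om R).
Implicit Types (X : nat -> {RV P >-> borel T}).

(** Off a measurable null set containing all points of divergence the sequence is
    unchanged; on this null set it is replaced by a constant. *)
Lemma ae_cvg_limit_RV X :
  {ae P, forall w, exists z : T, (fun n => X n w : T) @ \oo --> z} ->
  exists Z : {RV P >-> borel T},
    {ae P, forall w, (fun n => X n w : T) @ \oo --> (Z w : T)}.
Proof.
move=> [N [mN PN sN]].
pose Y n w : borel T := if w \in ~` N then X n w else (point : T).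
have mY n : measurable_fun setT (Y n).
  apply: measurable_fun_ifT.
  - apply: (measurable_fun_bool true) => //.
    rewrite setTI (_ : _ @^-1` _ = ~` N); first exact: measurableC.
    by apply/seteqP; split => w /= => [/set_mem|/mem_set].
  - exact: measurable_funPT.
  - exact: measurable_cst.
have YX w : w \in ~` N -> (fun n => Y n w : T) = (fun n => X n w : T).
  by move=> wN; apply/funext => n; rewrite /Y wN.
have /choice[Z YZ] : forall w, exists z : T, (fun n => Y n w : T) @ \oo --> z.
  move=> w; have [wN|wN] := boolP (w \in ~` N).
    rewrite YX //; apply: contrapT => h; move: wN; rewrite inE; apply.
    exact: sN.
  exists point; have -> : (fun n => Y n w : T) = cst point.
    by apply/funext => n; rewrite /Y (negbTE wN).
  exact: cvg_cst.
have mZ : measurable_fun setT (Z : Om -> borel T) by exact: limit_measurable mY YZ.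
pose ZM := isMeasurableFun.Build _ _ _ _ (Z : Om -> borel T) mZ.
pose ZP : {RV P >-> borel T} := HB.pack (Z : Om -> borel T) ZM.
exists ZP; exists N; split => // w /= h; apply: contrapT => wN; apply: h.
by rewrite -YX; [exact: YZ|rewrite inE].
Qed.

Lemma ae_cvg_weak_cvg X (Z : {RV P >-> borel T}) :
  {ae P, forall w, (fun n => X n w : T) @ \oo --> (Z w : T)} ->
  weak_cvg (fun n => distribution P (X n)) (distribution P Z).
Proof.
move=> XZ F cF [M FM].
have mF := continuous_borel_measurable cF.
have M0 : 0 <= M by apply: le_trans (FM point); exact: normr_ge0.
have mFX (V : {RV P >-> borel T}) : measurable_fun setT (fun w => F (V w)).
  by apply: (measurableT_comp mF); exact: measurable_funPT.
have iFX (V : {RV P >-> borel T}) : P.-integrable setT (EFin \o (fun w => F (V w))).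
  apply: measurable_bounded_integrable => //.
    by apply: le_lt_trans (probability_le1 P measurableT) _; rewrite ltry.
  by exists M; split; [exact: num_real|move=> x Mx w _; apply: le_trans (FM _) (ltW Mx)].
have iE (V : {RV P >-> borel T}) :
    \int[distribution P V]_g F g = fine (\int[P]_w (F (V w))%:E)%E.
  rewrite /Rintegral; congr fine; rewrite integral_distribution //.
    exact/measurable_EFinP.
  exact: iFX.
rewrite iE; under eq_cvg do rewrite iE.
apply: fine_cvg; rewrite fineK; last first.
  by apply: integrable_fin_num => //; exact: iFX.
have [|||||_ _] // := @dominated_convergence _ Om R P setT measurableT
  (fun n w => (F (X n w))%:E) (fun w => (F (Z w))%:E) (cst M%:E).
- by move=> n; apply/measurable_EFinP; exact: mFX.
- by apply/measurable_EFinP; exact: mFX.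
- apply: filterS XZ => w XZw _; apply: cvg_EFin; first exact: nearW.
  exact: (cvg_comp _ _ XZw (cF _)).
- exact: finite_measure_integrable_cst.
- by apply: aeW => w n _; rewrite lee_fin; exact: FM.
Qed.

End almost_sure_limits.

(** * Finite-volume processes *)

Section path_balls.
Context {R : realType} {rho : nat -> {posnum R}}.

Lemma path_ball_sym k (g h : Omega_Spin rho) : path_ball k g h -> path_ball k h g.
Proof. by move=> gh t tk; rewrite distrC; exact: gh. Qed.

Let ler_lt_distD (V : normedModType R) (p q r : V) (e1 e2 : R) :
  `|p - q| < e1 -> `|q - r| < e1 -> e1 + e1 = e2 -> `|p - r| < e2.
Proof.
by move=> pq qr <-; apply: le_lt_trans (ler_distD q _ _) _; exact: ltrD.
Qed.

Lemma path_ball_split k : exists k', forall g h l : Omega_Spin rho,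
  path_ball k' g h -> path_ball k' h l -> path_ball k g l.
Proof.
exists (k + k).+1 => g h l gh hl t tk.
have tk' : \val t <= (k + k).+1%:R.
  by apply: le_trans tk _; rewrite ler_nat; clear; lia.
apply: ler_lt_distD (gh t tk') (hl t tk') _.
have -> : (k + k).+2%:R = k.+1%:R + k.+1%:R :> R.
  by rewrite -natrD addSn addnS.
by field; rewrite nat1r pnatr_eq0 /= -natrD pnatr_eq0.
Qed.

End path_balls.

Section extension_to_the_line.
Context {R : realType}.

(** Precomposing with the positive part extends a path from the half-line to a
    continuous path on the line. *)
Lemma continuous_comp_max0 (g : R -> R) :
  {within [set t : R | 0 <= t], continuous g} ->
  continuous (fun t : R => g (Num.max 0 t)).
Proof.
move=> /subspace_sigL_continuousP cg t.
have -> : (fun t => g (Num.max 0 t)) = sigL [set t : R | 0 <= t] g \o @pos_part R.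
  by apply/funext => s.
apply: continuous_comp; last exact: cg.
exact: pos_part_continuous.
Qed.

End extension_to_the_line.

Section finite_volume_paths.
Context {R : realType} d {Omega : measurableType d}.

Lemma finite_volume_path_solution a f (W : R -> Omega -> R) n x
    (X : nat -> R -> Omega -> R) (w : Omega) :
  (forall t, X 0%N t w = 0) -> (forall t, X n.+1 t w = 0) ->
  (forall i, (1 <= i <= n)%N ->
        {within [set t : R | 0 <= t], continuous (fun t => X i t w)} /\
        forall t, 0 <= t ->
          X i t w = x i
            + \int[lebesgue_measure]_(s in `[0, t])
                (a i i.-1 * X i.-1 s w + a i i.+1 * X i.+1 s w + f (X i s w))
            + (if i == 1%N then W t w else 0)) ->
  path_solution a f (fun t => W (Num.max 0 t) w) x n
    (fun i t => X i (Num.max 0 t) w).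
Proof.
move=> X0 Xn HX; split => // i.
  by move=> iln; exact: (continuous_comp_max0 (HX i iln).1).
move=> t iln t0; have [_ ->] := HX i iln; last by rewrite (max_idPr t0).
rewrite (max_idPr t0) addrAC; congr (_ + _).
apply: eq_Rintegral => s; rewrite inE /= in_itv/= => /andP[s0 _].
by rewrite /drift (max_idPr s0).
Qed.

End finite_volume_paths.

Unset Implicit Arguments.
Set Strict Implicit.
Set Printing Implicit Defensive.

Theorem theorem3p22 (R : realType)
  (d : measure_display) (Omega : measurableType d) (P : probability Omega R)
  (W1 : R -> {RV P >-> R}) (hW1 : brownian_motion W1)
  (theta M N eta lam eta0 Rad : R)
  (htheta : 1 <= theta) (hM : 0 < M) (hN : 0 < N) (heta : 0 < eta)
  (hlam : 1 / 2 < lam) (heta0 : 0 <= eta0) (hRad : 1 <= Rad)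
  (rho : nat -> {posnum R})
  (hrho_sum : (\sum_(1 <= i <oo) ((rho i)%:num)%:E < +oo)%E)
  (hrho_ratio : forall g j : nat, (1 <= g)%N -> (1 <= j)%N ->
     `|g%:R - j%:R| <= Rad -> (rho g)%:num / (rho j)%:num <= N)
  (a : nat -> nat -> R) (ha10 : a 1%N 0%N = 0)
  (ha_neq0 : forall i, (2 <= i)%N -> a i i.-1 != 0)
  (ha_bound : forall i, (2 <= i)%N ->
     Num.max `|a i.-1 i| `|a i i.-1| <= M)
  (f : R -> R) (hf_smooth : smooth f)
  (hf_diss : forall z, f z * z <= eta - lam * `|z| ^+ 2)
  (hf_growth : forall z, `|f z| <= eta0 * (1 + `|z| `^ theta))
  (hMlam : 2 * M < lam - 1 / 2)
  (r M1 M2 : R) (N1 : nat)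
  (hr : 0 < r) (hM1 : 0 < M1) (hM2 : 0 < M2) (hN1 : (1 <= N1)%N)
  (hrho_lower : forall n : nat, (N1 <= n)%N ->
     M1 * expR (- r * n%:R) <= (rho n)%:num)
  (hrho_limsup :
     (limn_esup (fun n : nat =>
        ((rho n)%:num / inf [set (rho i)%:num | i in [set i | 1 <= i <= n]%N])%:E)
      <= M2%:E)%E)
  (f1 f2 f3 : R -> R) (hf_decomp : forall z, f z = f1 z + f2 z + f3 z)
  (hf2 : exists K : R, forall z z' : R, `|f2 z - f2 z'| <= K * `|z - z'|)
  (hf3 : exists xi : R,
     {homo (fun z => f3 z + xi * z) : z z' / z <= z' >-> z' <= z})
  (L : nat -> R) (hL : forall n, 0 < L n)
  (hf1 : forall (n : nat) (z z' : R),
     - n%:R <= z <= n%:R -> - n%:R <= z' <= n%:R ->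
     `|f1 z - f1 z'| <= L n * `|z - z'|)
  (hL_growth : forall C : R, 0 < C -> exists gam : R, 0 < gam /\
     expR (C * L n ^+ 2) / (n%:R `^ gam * L n) @[n --> \oo] --> (0 : R))
  (x : nat -> R) (hx : x \in ell (2 * theta) rho)
  (X : nat -> nat -> R -> Omega -> R)
  (hX : forall n, (1 <= n)%N -> finite_volume_solution P a f W1 n x (X n))
  (Xt : nat -> {RV P >-> borel (Omega_Spin rho)})
  (hXt : forall n, (1 <= n)%N -> zero_extension P n (X n) (Xt n))
  (m n : nat -> nat)
  (hm_mono : {homo m : i j / (i <= j)%N}) (hm : m j @[j --> \oo] --> \oo)
  (hn_mono : {homo n : i j / (i <= j)%N}) (hn : n j @[j --> \oo] --> \oo) :
  exists Px : probability (borel (Omega_Spin rho)) R,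
    weak_cvg (fun j => distribution P (Xt (m j))) Px /\
    weak_cvg (fun j => distribution P (Xt (n j))) Px.
Proof.
have cf : continuous f.
  move=> z; apply: differentiable_continuous; apply/derivable1_diffP.
  exact: (hf_smooth 0%N z).
have f_le z : 1 < z -> f z <= eta.
  move=> z1; have := hf_diss z; have z0 : 0 < z by lra.
  have : 0 <= lam * `|z| ^+ 2 by rewrite mulr_ge0 ?sqr_ge0 //; lra.
  move: (lam * _) => u u0 fz.
  rewrite leNgt; apply/negP => fe; nra.
have f_ge z : z < -1 -> - eta <= f z.
  move=> z1; have := hf_diss z.
  have : 0 <= lam * `|z| ^+ 2 by rewrite mulr_ge0 ?sqr_ge0 //; lra.
  move: (lam * _) => u u0 fz.
  rewrite leNgt; apply/negP => fe; nra.
have rho_ratio i : (1 <= i)%N -> (rho i)%:num <= N * (rho i.+1)%:num /\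
    (rho i.+1)%:num <= N * (rho i)%:num.
  move=> i1; rewrite -!ler_pdivrMr //; split; apply: hrho_ratio => //.
    by rewrite -natr1 opprD addNKr normrN1.
  by rewrite -natr1 addrAC subrr add0r normr1.
have aM i : (1 <= i)%N -> `|a i i.-1| <= M /\ `|a i i.+1| <= M.
  move=> i1; split; last first.
    by have := ha_bound i.+1 i1; rewrite ge_max => /andP[].
  case: i i1 => [//|[|i]] _; first by rewrite ha10 normr0 ltW.
  by have := ha_bound i.+2 isT; rewrite ge_max => /andP[].
have [K2 hK2] := hf2; have [xi hxi] := hf3.
have fL (k : nat) (y z : R) : `|y| <= k%:R -> `|z| <= k%:R -> z <= y ->
    f y - f z <= (L k + (`|K2| + `|xi|)) * (y - z).
  rewrite !ler_norml => yk zk zy.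
  have yz0 : 0 <= y - z by rewrite subr_ge0.
  have := le_trans (ler_norm _) (hf1 _ _ _ yk zk).
  have := le_trans (ler_norm _) (hK2 y z).
  have := hxi _ _ zy; rewrite (ger0_norm yz0) !hf_decomp.
  have := ler_wpM2r yz0 (ler_norm K2).
  have := ler_wpM2r yz0 (ler_norm (- xi)); rewrite normrN.
  lra.
have L_sub (k0 : nat) : (2 <= k0)%N -> forall dlt : R, 0 < dlt ->
    exists C : R, \forall n \near \oo, L (k0 ^ n)%N <= dlt * n%:R + C.
  have [gam [gam0 cvgL]] := hL_growth 1 ltr01.
  move=> k02; apply: (sublinear_along_powers k02 hL gam0).
  by under eq_fun do rewrite -[X in expR X]mul1r.
have K0 : 0 <= `|K2| + `|xi| by rewrite addr_ge0.
have [_ Wcont _ _] := hW1.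
(* One null set serves all volumes, so that they can be compared along the same
   noise path. *)
have aeX : {ae P, forall w, forall k, (1 <= k)%N -> forall i, (1 <= i <= k)%N ->
        {within [set t : R | 0 <= t], continuous (fun t => X k i t w)} /\
        forall t, 0 <= t ->
          X k i t w = x i
            + \int[lebesgue_measure]_(s in `[0, t])
                (a i i.-1 * X k i.-1 s w + a i i.+1 * X k i.+1 s w + f (X k i s w))
            + (if i == 1%N then W1 t w else 0)}.
  apply: ae_foralln => k; case: (leqP 1 k) => k1; last by apply: aeW.
  by have [_ _ _] := hX k k1; apply: filterS => w h _.
have aeXt : {ae P, forall w, forall k, (1 <= k)%N -> forall (t : Rplus R) (i : nat),
    Xt k w t i = if (1 <= i <= k)%N then X k i (\val t) w else 0}.
  apply: ae_foralln => k; case: (leqP 1 k) => k1; last by apply: aeW.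
  by have := hXt k k1; apply: filterS => w h _.
have [Z XZ] : exists Z : {RV P >-> borel (Omega_Spin rho)},
   {ae P, forall w, (fun n => Xt n w : Omega_Spin rho) @ \oo -->
      (Z w : Omega_Spin rho)}.
  apply: (ae_cvg_limit_RV (@nbhs_path_ball R rho) (@path_ball_sym R rho)
    (@path_ball_split R rho)).
  move: Wcont aeX aeXt; apply: filterS3 => w cW HX HXt.
  pose Y k (i : nat) (t : R) := X k i (Num.max 0 t) w.
  have sY k : (1 <= k)%N ->
      path_solution a f (fun t => W1 (Num.max 0 t) w) x k (Y k).
    move=> k1; have [X0 Xk _ _] := hX k k1.
    exact: (@finite_volume_path_solution R d Omega a f (fun t => W1 t) k x (X k) w
      (X0^~ w) (Xk^~ w) (HX k k1)).
  have uY k (t : Rplus R) i : (1 <= i <= k)%N -> Xt k w t i = Y k i (\val t).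
    move=> ik; have k1 : (1 <= k)%N by move: ik; clear; lia.
    rewrite HXt // ik /Y (max_idPr _) //.
    by have := valP t; rewrite inE.
  have vge0 (t : Rplus R) : 0 <= \val t by have := valP t; rewrite inE.
  apply: Omega_Spin_dominated_cvg => T T0.
  have [beta [beta0 bsum bound cauchy]] :=
    path_solutions_cauchy htheta hM hN (ltW heta) hrho_sum rho_ratio aM cf f_le
      f_ge hL K0 fL L_sub hx (continuous_comp_max0 cW) T0.
  exists beta; split => //.
  - move=> k t i k1 tT i1; have [ik|ki] := leqP i k.
      by rewrite uY ?i1 //; apply: bound; [exact: sY|rewrite i1|rewrite vge0].
    by rewrite HXt // (leqNgt i k) ki andbF normr0 beta0.
  - move=> i i1; have [eps eps0 epsP] := cauchy i; exists eps => //.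
    move=> k l t k1 ik kl tT; rewrite !uY ?i1 ?(leq_trans ik kl) //.
    have vt : 0 <= \val t <= T by rewrite vge0.
    exact: (epsP _ _ _ _ kl (sY k k1) (sY l (leq_trans k1 kl)) ik _ vt).
(* The whole sequence of laws converges, hence so do both subsequences. *)
have wc := ae_cvg_weak_cvg XZ.
exists (distribution P Z); split => F cF bF.
  exact: (cvg_comp _ _ hm (wc F cF bF)).
exact: (cvg_comp _ _ hn (wc F cF bF)).
Qed.
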